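(* Let $2\le s<\infty$ with Hölder conjugate $s'$, and let $\mathcal R(\varphi)$ be either one of the following two quantities: (i) $\mathcal R(\varphi)=\dfrac{\|\varphi\|_{L^p(\mathbb T)}\|\varphi\|_{L^q(\mathbb T)}}{\|\varphi\|_{L^r(\mathbb T)}}$, where $1\le p,q,r\le\infty$ satisfy $\frac1p+\frac1q-\frac1r\ge 1+\frac1s$; or (ii) $\mathcal R(\varphi)=\dfrac{\|\varphi\|_{L^1(\mathbb T)}^{1+r'/s}}{\|\varphi\|_{L^r(\mathbb T)}^{r'/s}}$, where $r\in(1,\infty]$ and $r'$ is the Hölder conjugate of $r$. Then there exists a constant $C>0$, depending only on $p,q,r,s$ (only on $r,s$ in case (ii)), such that for all nonzero $\varphi\in C(\mathbb T,\mathbb R)$ with zero mean and $N_\varphi<\infty$, all real $M\ge\|\varphi_-\|_{L^\infty(\mathbb T)}$, and all integers $n\ge 1$, $$N_\varphi\left[\frac Mn+\Big(\sum_{k=1}^{n-1}\frac{|\hat\varphi(k)|^{s'}}{k^{s'}}\Big)^{1/s'}\right]\;\ge\; C\,\mathcal R(\varphi).$$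
   Context: $\mathbb T=\mathbb R/\mathbb Z$ is the one-dimensional torus with normalized Lebesgue measure (total mass $1$); $\hat\varphi(k)=\int_{\mathbb T}\varphi(x)e^{-2\pi i kx}\,dx$; zero mean means $\int_{\mathbb T}\varphi\,dx=0$; $\varphi_-=\max(-\varphi,0)$ is the negative part of $\varphi$. $N_\varphi$ denotes the number of times $\varphi$ changes sign on $\mathbb T$, i.e. the largest $m$ for which there are cyclically ordered distinct points $x_1,\dots,x_m\in\mathbb T$ with $\varphi(x_j)\varphi(x_{j+1})<0$ for $j=1,\dots,m$, where $x_{m+1}:=x_1$. The convention $1/\infty=0$ is used, and an empty sum is $0$. *)

(* Defs.v *)
From HB Require Import structures.
From mathcomp Require Import all_boot all_order all_algebra.
From mathcomp Require Import all_classical all_reals all_analysis.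
From mathcomp Require Import complex.

Set Implicit Arguments.
Unset Strict Implicit.
Unset Printing Implicit Defensive.

Import Order.TTheory GRing.Theory Num.Theory.
Import numFieldNormedType.Exports.

Local Open Scope classical_set_scope.
Local Open Scope ring_scope.

(* Functions on the torus R/Z are represented by 1-periodic functions on R, and
   the normalized Lebesgue measure of the torus by the uniform probability
   measure on [0, 1]. *)
Definition torus_measure (R : realType) : probability (measurableTypeR R) R :=
  uniform_prob (@ltr01 R).

Definition torus_continuous (R : realType) (phi : R -> R) : Prop :=
  continuous phi /\ periodic phi 1.

(* Real-valued; since Lnorm takes values in \bar R, it is meaningful when that
   norm is finite, as it is for continuous phi and 1 <= p <= +oo. *)
Definition Lp_norm (R : realType) (p : \bar R) (phi : R -> R) : R :=
  fine ('N[torus_measure R]_p[EFin \o phi])%E.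

(* The integral of phi(x) e^(-2 i pi k x), split into real and imaginary parts
   for real-valued phi. *)
Definition fourier_coef (R : realType) (phi : R -> R) (k : int) : R[i] :=
  Complex (\int[torus_measure R]_x (phi x * cos (2 * pi * k%:~R * x)))
          (- \int[torus_measure R]_x (phi x * sin (2 * pi * k%:~R * x))).

Definition zero_mean (R : realType) (phi : R -> R) : Prop :=
  \int[torus_measure R]_x phi x = 0.

(* Cyclically ordered distinct points of the torus, given (up to a cyclic
   rotation) by their increasing representatives in [0, 1), such that phi takes
   opposite signs at cyclically consecutive points. *)
Definition alternating_points (R : realType) (phi : R -> R) (xs : seq R) : bool :=
  [&& all (fun x => 0 <= x < 1) xs,
      sorted <%R xs &
      path.cycle (fun x y => phi x * phi y < 0) xs].

(* N_phi, with value +oo when there is no largest number of points. *)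
Definition sign_changes (R : realType) (phi : R -> R) : \bar R :=
  ereal_sup [set ((size xs)%:R)%:E | xs in [set xs | alternating_points phi xs]].

(* Main.v *)
Require Import Defs.
From HB Require Import structures.
From mathcomp Require Import all_boot all_order all_algebra.
From mathcomp Require Import all_classical all_reals all_analysis.
From mathcomp Require Import complex.
From mathcomp Require Import measurable_realfun ess_sup_inf ring lra.
Import Order.TTheory GRing.Theory Num.Theory.
Import numFieldNormedType.Exports.
Local Open Scope classical_set_scope.
Local Open Scope ring_scope.

(** Write N for the number of sign changes, X for the bracket on the right-hand side
    and Phi for the primitive of phi, normalised as the convolution of phi with the
    sawtooth 1 / 2 - x. The measure of a level set of Phi is bounded from both sides,
    and the comparison of the two bounds is the theorem.

    From below. On an interval where phi keeps its sign Phi is monotone, so the part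
    of the interval where |Phi| <= lam carries a mass of |phi| of at most 2 lam. As
    [0, 1) is a union of at most 2 N such intervals, the choice
    lam = |phi|_1 / (8 N) leaves half of the mass of |phi| on the set A where
    |Phi| >= lam (large_prim_mass), and Hoelder gives
    |A| >= (|phi|_1 / (2 |phi|_r)) ^ r' (mass_on_set_le).

    From above. The sawtooth differs from a trigonometric polynomial of degree less
    than n, its Riesz mean, by at most another such polynomial H whose mean is
    O(1 / n) (saw_err_le_major). Since phi + M >= 0, this can be integrated against
    phi + M: up to 32 M / n, |Phi| is at most the sum of two trigonometric
    polynomials whose k-th amplitudes are O(|phi^(k)| / k) (norm_prim_le). Only the
    measure of one level set is wanted, so a weak-type form of the Hausdorff-Young
    inequality is enough, and that form follows from Parseval by separating the
    frequencies with large and with small amplitude (weak_hausdorff_young). The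
    outcome is |A| <= 2 (512 X / lam) ^ s (prim_level_set_le).

    Together these give N X >= C |phi|_r t ^ (1 + r' / s) with
    t = |phi|_1 / |phi|_r, where C depends on r and s only (sign_change_bound). This
    is the second case of the theorem. The first reduces to it: interpolation between
    L^1 and L^r bounds |phi|_p and |phi|_q by |phi|_r times powers of t, and t <= 1
    (norm_product_ratio_le). *)

(** * The Dirichlet, Fejer and Riesz kernels *)

(** n times the Fejer kernel, with period pi in x. *)
Definition fejer {R : realType} (n : nat) (x : R) : R :=
  n%:R + 2 * \sum_(1 <= k < n) (n%:R - k%:R) * cos (2 * k%:R * x).

(** n ^ 2 times the kernel of the Riesz means with weights 1 - (k / n) ^ 2, with
    period pi in x. *)
Definition riesz {R : realType} (n : nat) (x : R) : R :=
  n%:R ^+ 2 + 2 * \sum_(1 <= k < n) (n%:R ^+ 2 - k%:R ^+ 2) * cos (2 * k%:R * x).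

Lemma norm_sin_natmul_le (R : realType) (k : nat) (x : R) :
  `|sin (k%:R * x)| <= k%:R * `|sin x|.
Proof.
elim: k => [|k IH]; first by rewrite !mul0r sin0 normr0.
rewrite -(@natr1 R k) !mulrDl !mul1r sinD (le_trans (ler_normD _ _))// lerD//.
- by rewrite normrM (le_trans _ IH)// ler_piMr// cos_max.
- by rewrite normrM ler_piMl// cos_max.
Qed.

Lemma dirichlet_kernelE (R : realType) (n : nat) (x : R) :
  (1 + 2 * \sum_(1 <= k < n.+1) cos (2 * k%:R * x)) * sin x
    = sin ((2 * n%:R + 1) * x).
Proof.
elim: n => [|n IH]; first by rewrite big_geq// !mulr0 addr0 add0r !mul1r.
rewrite big_nat_recr//= mulrDr addrA mulrDl IH -(@natr1 R n).
have -> : (2 * n%:R + 1) * x = 2 * (n%:R + 1) * x - x by ring.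
have -> : (2 * (n%:R + 1) + 1) * x = 2 * (n%:R + 1) * x + x by ring.
rewrite sinB sinD; ring.
Qed.

Lemma fejerS (R : realType) (n : nat) (x : R) :
  fejer n.+1 x = fejer n x + (1 + 2 * \sum_(1 <= k < n.+1) cos (2 * k%:R * x)).
Proof.
rewrite /fejer; case: n => [|n]; first by rewrite !big_geq//; ring.
rewrite !(big_nat_recr n.+1)//= -[in LHS](@natr1 R n.+1).
under eq_bigr do rewrite addrAC mulrDl mul1r.
by rewrite big_split/=; ring.
Qed.

(** The left factor is the sum of the first n Dirichlet kernels, so the identity
    telescopes in n. *)
Lemma fejer_closed (R : realType) (n : nat) (x : R) :
  fejer n x * sin x ^+ 2 = sin (n%:R * x) ^+ 2.
Proof.
elim: n => [|n IH].
  by rewrite /fejer big_geq// mul0r sin0 mulr0 addr0 mul0r expr0n.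
rewrite fejerS mulrDl IH expr2 mulrA dirichlet_kernelE.
have -> : (2 * n%:R + 1) * x = n%:R * x + n.+1%:R * x by rewrite -(@natr1 R n); ring.
have e : sin x = sin (n.+1%:R * x - n%:R * x) by congr sin; rewrite -(@natr1 R n); ring.
rewrite e sinD sinB.
have := cos2Dsin2 (n%:R * x); have := cos2Dsin2 (n.+1%:R * x).
set a := sin _; set b := cos _; set c := sin (_ * x); set d := cos (n%:R * x).
move=> h1 h2.
have -> : (c * b + d * a) * (a * d - b * c) = a ^+ 2 * (d ^+ 2) - c ^+ 2 * b ^+ 2 by ring.
have -> : d ^+ 2 = 1 - c ^+ 2 by rewrite -h2; ring.
have -> : b ^+ 2 = 1 - a ^+ 2 by rewrite -h1; ring.
by ring.
Qed.

(** The closed form gives the sign except where sin x = 0; there every cosine of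
    the sum equals 1. *)
Lemma fejer_ge0 (R : realType) (n : nat) (x : R) : 0 <= fejer n x.
Proof.
have [s0|s0] := eqVneq (sin x) 0; last first.
  have : 0 <= fejer n x * sin x ^+ 2 by rewrite fejer_closed sqr_ge0.
  by rewrite pmulr_lge0// exprn_even_gt0.
rewrite addr_ge0// mulr_ge0// big_nat_cond sumr_ge0// => k /andP[/andP[_ kn] _].
rewrite mulr_ge0//; first by rewrite subr_ge0 ler_nat ltnW.
have -> : 2 * k%:R * x = (k%:R * x) *+ 2 by rewrite mulr2n; ring.
have : `|sin (k%:R * x)| <= 0.
  by rewrite (le_trans (norm_sin_natmul_le _ _ _))// s0 normr0 mulr0.
rewrite normr_le0 => /eqP k0; rewrite cos_mulr2n cos2sin2 k0.
by rewrite expr0n/= subr0 mulr2n addrK.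
Qed.

(** Passing from n to n + 1 adds 2 n + 1 times a Dirichlet kernel, and the right
    side grows by the same amount by the addition formulas. *)
Lemma riesz_closed (R : realType) (n : nat) (x : R) :
  riesz n x * (2 * sin x ^+ 3) =
  sin (2 * n%:R * x) * cos x - 2 * n%:R * cos (2 * n%:R * x) * sin x.
Proof.
elim: n => [|n IH].
  by rewrite /riesz big_geq// !mulr0 !mul0r sin0; ring.
have -> : riesz n.+1 x = riesz n x +
    (2 * n%:R + 1) * (1 + 2 * \sum_(1 <= k < n.+1) cos (2 * k%:R * x)).
  rewrite /riesz; case: (n) => [|m]; first by rewrite !big_geq//; ring.
  rewrite !(big_nat_recr m.+1)//= -[in LHS](@natr1 R m.+1).
  set M := m.+1%:R.
  under [X in _ + 2 * (X + _) = _]eq_bigr => k _.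
    have -> : ((M + 1) ^+ 2 - k%:R ^+ 2) * cos (2 * k%:R * x)
      = (M ^+ 2 - k%:R ^+ 2) * cos (2 * k%:R * x)
        + (2 * M + 1) * cos (2 * k%:R * x) by ring.
    over.
  by rewrite big_split/= -mulr_sumr; ring.
rewrite mulrDl IH.
have -> : 2 * n.+1%:R * x = (2 * n%:R + 1) * x + x by rewrite -(@natr1 R n); ring.
have -> : 2 * n%:R * x = (2 * n%:R + 1) * x - x by ring.
have -> : (2 * n%:R + 1) * (1 + 2 * \sum_(1 <= k < n.+1) cos (2 * k%:R * x))
   * (2 * sin x ^+ 3) = 2 * (2 * n%:R + 1) * sin ((2 * n%:R + 1) * x) * sin x ^+ 2.
  by rewrite -dirichlet_kernelE; ring.
rewrite -(@natr1 R n) sinB cosB sinD cosD.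
set a := sin _; set b := cos _; set c := sin x; set d := cos x.
have h := cos2Dsin2 x.
by ring.
Qed.

Lemma is_derive_scaled_sin (R : realType) (a x : R) :
  is_derive x 1 (fun y => sin (a * y)) (a * cos (a * x)).
Proof.
have h : is_derive x 1 (fun y : R => a * y) a.
  by apply: is_derive_eq; rewrite /GRing.scale/= mulr1.
have := is_derive1_comp (is_derive_sin (a * x)) h.
by rewrite mulrC /GRing.scale/=.
Qed.

Lemma is_derive_scaled_cos (R : realType) (a x : R) :
  is_derive x 1 (fun y => cos (a * y)) (- (a * sin (a * x))).
Proof.
have h : is_derive x 1 (fun y : R => a * y) a.
  by apply: is_derive_eq; rewrite /GRing.scale/= mulr1.
have := is_derive1_comp (is_derive_cos (a * x)) h.
by rewrite mulrC mulrN.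
Qed.

Lemma is_derive_sum_nat (R : realType) (f : nat -> R -> R) (df : nat -> R)
    (m n : nat) (x : R) :
  (forall k, is_derive x 1 (f k) (df k)) ->
  is_derive x 1 (fun y => \sum_(m <= k < n) f k y) (\sum_(m <= k < n) df k).
Proof.
move=> h; elim: n => [|n IH].
  rewrite big_geq//; under eq_fun do rewrite big_geq//; exact: is_derive_cst.
have [mn|nm] := leqP m n.
  rewrite big_nat_recr//=; under eq_fun do rewrite big_nat_recr//=.
  exact: is_deriveD.
rewrite big_geq//; under eq_fun do rewrite big_geq//; exact: is_derive_cst.
Qed.

Lemma is_derive_inv (R : realType) (f : R -> R) (x df : R) : f x != 0 ->
  is_derive x 1 f df -> is_derive x 1 (fun y => (f y)^-1) (- df / f x ^+ 2).
Proof.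
move=> f0 [d e]; split; first exact: derivableV.
by rewrite deriveV// e /GRing.scale/= mulrC mulrN mulNr.
Qed.

Lemma le_of_nonneg_derive (R : realType) (f df : R -> R) (a b : R) :
  a <= b -> (forall x, a <= x <= b -> is_derive x 1 f (df x)) ->
  (forall x, a <= x <= b -> 0 <= df x) -> f a <= f b.
Proof.
move=> ab h h0.
have sub x : x \in `]a, b[%R -> a <= x <= b.
  by rewrite in_itv/= => /andP[/ltW -> /ltW ->].
apply: (@ger0_derive1_ndecr R f a b) => //.
- by move=> x /sub xab; have [] := h x xab.
- by move=> x /sub xab; rewrite derive1E; have [_ ->] := h x xab; apply: h0.
- by apply: derivable_within_continuous => x; rewrite in_itv/= => xab; have [] := h x xab.
Qed.

(** * Riesz means of the sawtooth *)

Definition riesz_coef {R : realType} (n k : nat) : R :=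
  (1 - (k%:R / n%:R) ^+ 2) / (pi * k%:R).

(** The Riesz mean of the Fourier series of the sawtooth 1 / 2 - x on (0, 1). *)
Definition riesz_saw {R : realType} (n : nat) (x : R) : R :=
  \sum_(1 <= k < n) riesz_coef n k * sin (2 * pi * k%:R * x).

Definition saw_err {R : realType} (n : nat) (x : R) : R :=
  1 / 2 - x - riesz_saw n x.

Lemma is_derive_saw_err (R : realType) (n : nat) (x : R) : (0 < n)%N ->
  is_derive x 1 (saw_err n) (- (riesz n (pi * x) / n%:R ^+ 2)).
Proof.
move=> n0.
have nn : (n%:R : R) != 0 by rewrite pnatr_eq0 -lt0n.
have h1 : is_derive x 1 (riesz_saw n)
    (\sum_(1 <= k < n) riesz_coef n k * (2 * pi * k%:R * cos (2 * pi * k%:R * x))).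
  apply: is_derive_sum_nat => k.
  have := is_deriveZ (riesz_coef n k) (is_derive_scaled_sin _ (2 * pi * k%:R) x).
  by apply.
have h2 : is_derive x 1 (fun y : R => 1 / 2 - y) (- 1).
  by have := is_deriveB (is_derive_cst (1 / 2 : R) x 1) (is_derive_id x 1); rewrite sub0r.
apply: is_derive_eq (is_deriveB h2 h1) _.
rewrite /riesz (mulrDl (n%:R ^+ 2)) opprD divff ?expf_neq0//; congr (_ - _).
rewrite [RHS]mulrAC mulr_sumr; apply: eq_big_nat => k /andP[k1 kn].
have kk : (k%:R : R) != 0 by rewrite pnatr_eq0 -lt0n.
have pp : (pi : R) != 0 by rewrite gt_eqF// pi_gt0.
rewrite /riesz_coef; have -> : 2 * k%:R * (pi * x) = 2 * pi * k%:R * x by ring.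
by move: (pi : R) pp => p pp; field; rewrite nn pp kk.
Qed.

Lemma sin_pi_nat (R : realType) (k : nat) : sin (pi * k%:R) = 0 :> R.
Proof.
have := norm_sin_natmul_le R k pi.
by rewrite sinpi normr0 mulr0 normr_le0 mulrC => /eqP.
Qed.

Lemma cos_2pi_nat (R : realType) (k : nat) : cos (2 * pi * k%:R) = 1 :> R.
Proof.
have -> : 2 * pi * k%:R = (pi * k%:R) *+ 2 :> R by rewrite mulr2n; ring.
by rewrite cos_mulr2n cos2sin2 sin_pi_nat expr0n/= subr0 mulr2n addrK.
Qed.

Lemma sin_2pi_nat (R : realType) (k : nat) : sin (2 * pi * k%:R) = 0 :> R.
Proof.
have -> : 2 * pi * k%:R = (pi * k%:R) *+ 2 :> R by rewrite mulr2n; ring.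
by rewrite sin_mulr2n sin_pi_nat mulr0 mul0rn.
Qed.

Lemma saw_err_half (R : realType) (n : nat) : saw_err n (1 / 2) = 0 :> R.
Proof.
rewrite /saw_err /riesz_saw big1_seq ?subrr ?subr0// => k _.
have -> : 2 * pi * k%:R * (1 / 2) = pi * k%:R :> R by move: (pi : R) => p; field.
by rewrite sin_pi_nat mulr0.
Qed.

Lemma saw_err_onem (R : realType) (n : nat) (x : R) :
  saw_err n (1 - x) = - saw_err n x.
Proof.
rewrite /saw_err.
have -> : riesz_saw n (1 - x) = - riesz_saw n x.
  rewrite /riesz_saw -sumrN; apply: eq_bigr => k _.
  rewrite mulrBr mulr1 sinB sin_2pi_nat cos_2pi_nat; ring.
lra.
Qed.

(** For c = 1 and c = - 1 this brackets the error saw_err on (0, 1 / 2]: the first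
    term is what remains of the error after one integration by parts of the
    oscillating part of the kernel, and the term in c makes the difference with the
    error monotone. *)
Definition saw_barrier {R : realType} (n : nat) (c x : R) : R :=
  (2 * sin (2 * pi * n%:R * x) + c) / (4 * pi * n%:R ^+ 2) * (sin (pi * x) ^+ 2)^-1.

(** The closed form of the Riesz kernel cancels the terms in cos (2 pi n x); what
    is left has on (0, 1 / 2] the sign of c for c = 1 and c = - 1. *)
Lemma is_derive_saw_errB_barrier (R : realType) (n : nat) (c x : R) :
  (0 < n)%N -> sin (pi * x) != 0 ->
  is_derive x 1 (fun y => saw_err n y - saw_barrier n c y)
    (cos (pi * x) * (sin (2 * pi * n%:R * x) + c)
       / (2 * n%:R ^+ 2 * sin (pi * x) ^+ 3)).
Proof.
move=> n0 s0.
have nn : (n%:R : R) != 0 by rewrite pnatr_eq0 -lt0n.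
have pp : (pi : R) != 0 by rewrite gt_eqF// pi_gt0.
pose a : R := (4 * pi * n%:R ^+ 2)^-1.
have d1 : is_derive x 1 (fun y => (2 * sin (2 * pi * n%:R * y) + c) * a)
   (2 * (2 * pi * n%:R * cos (2 * pi * n%:R * x)) * a).
  have h0 := is_derive_scaled_sin _ (2 * pi * n%:R) x.
  have h1 := is_deriveZ 2 h0.
  have h2 := is_deriveD h1 (is_derive_cst c x 1).
  have h3 := is_deriveZ a h2.
  have -> : (fun y => (2 * sin (2 * pi * n%:R * y) + c) * a) =
    (a \*: ((2 \*: (fun y => sin (2 * pi * n%:R * y))) + cst c)).
    by apply/funext => y; rewrite mulrC.
  by apply: is_derive_eq h3 _; rewrite /GRing.scale/= addr0 mulrC.
have d2 : is_derive x 1 (fun y => sin (pi * y) ^+ 2)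
   (2 * sin (pi * x) * (pi * cos (pi * x))).
  by apply: is_derive_eq (is_deriveX 2 (is_derive_scaled_sin _ pi x)) _; rewrite /GRing.scale/= expr1.
have d3 := is_derive_inv _ (fun y => sin (pi * y) ^+ 2) _ _ (expf_neq0 2 s0) d2.
have d4 := is_deriveB (is_derive_saw_err _ _ x n0) (is_deriveM d1 d3).
apply: is_derive_eq d4 _; rewrite /GRing.scale/=.
have -> : riesz n (pi * x) =
   (sin (2 * n%:R * (pi * x)) * cos (pi * x)
     - 2 * n%:R * cos (2 * n%:R * (pi * x)) * sin (pi * x)) / (2 * sin (pi * x) ^+ 3).
  by rewrite -riesz_closed mulfK// mulf_neq0// expf_neq0.
have -> : 2 * n%:R * (pi * x) = 2 * pi * n%:R * x by ring.
by rewrite /a; move: (pi : R) pp s0 => p pp s0; field; rewrite nn pp s0.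
Qed.

(** The error minus a barrier is monotone up to 1 / 2, where the error vanishes and
    the barrier has an explicit value. The decay is quadratic in n x, which the
    error of the Fejer means does not have: it is of order 1 / (n x), whose integral
    exceeds 1 / n by a logarithm. *)
Lemma saw_err_far (R : realType) (n : nat) (x : R) :
  (0 < n)%N -> 0 < x <= 1 / 2 ->
  `|saw_err n x| <= 3 / (4 * pi * n%:R ^+ 2 * sin (pi * x) ^+ 2).
Proof.
move=> n0 /andP[x0 x2].
have nn : 0 < (n%:R : R) by rewrite ltr0n.
have pp : 0 < (pi : R) by exact: pi_gt0.
have sgt (y : R) : x <= y <= 1 / 2 -> 0 < sin (pi * y).
  move=> /andP[xy y2]; apply: sin_gt0_pi.
  have y0 : 0 < y by lra.
  by apply/andP; split; [exact: mulr_gt0 | rewrite gtr_pMr//; lra].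
have cge (y : R) : x <= y <= 1 / 2 -> 0 <= cos (pi * y).
  move=> /andP[xy y2]; apply: cos_ge0_pihalf; apply/andP; split.
    by rewrite (@le_trans _ _ 0)// ?oppr_le0 ?divr_ge0 ?mulr_ge0 ?ltW//; lra.
  by rewrite ler_pM2l//; lra.
have bh (c : R) : saw_barrier n c (1 / 2) = c / (4 * pi * n%:R ^+ 2).
  rewrite /saw_barrier.
  have -> : 2 * pi * n%:R * (1 / 2) = pi * n%:R :> R by move: (pi : R) => p; field.
  by rewrite sin_pi_nat mulr0 add0r mul1r sin_pihalf expr1n invr1 mulr1.
have S0 := sgt x; rewrite lexx x2 in S0; have {}S0 := S0 isT.
have den0 (y : R) : x <= y <= 1 / 2 -> 0 < 2 * n%:R ^+ 2 * sin (pi * y) ^+ 3.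
  by move=> h; rewrite mulr_gt0 ?exprn_gt0 ?mulr_gt0 ?exprn_gt0 ?sgt.
pose g (c y : R) := saw_err n y - saw_barrier n c y.
pose dg (c y : R) := cos (pi * y) * (sin (2 * pi * n%:R * y) + c)
       / (2 * n%:R ^+ 2 * sin (pi * y) ^+ 3).
have gd (c y : R) : x <= y <= 1 / 2 -> is_derive y 1 (g c) (dg c y).
  by move=> xy; apply: is_derive_saw_errB_barrier => //; rewrite gt_eqF// sgt.
have up : g 1 x <= g 1 (1 / 2).
  apply: (@le_of_nonneg_derive R (g 1) (dg 1) x (1 / 2) x2 (gd 1)) => y xy.
  apply: divr_ge0; [apply: mulr_ge0; first exact: cge | exact/ltW/den0].
  by rewrite -lerBlDr sub0r sin_geN1.
have lo : - g (-1) x <= - g (-1) (1 / 2).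
  apply: (@le_of_nonneg_derive R (fun y => - g (-1) y) (fun y => - dg (-1) y) x (1 / 2) x2).
    by move=> y xy; apply: is_deriveN; exact: gd.
  move=> y xy; rewrite -mulNr -mulrN.
  apply: divr_ge0; [apply: mulr_ge0; first exact: cge | exact/ltW/den0].
  by rewrite oppr_ge0 subr_le0 sin_le1.
rewrite /g in up lo.
move: up lo; rewrite saw_err_half !bh !sub0r.
have d0 : 0 < 4 * pi * n%:R ^+ 2 :> R by rewrite !mulr_gt0// exprn_gt0.
set b := 3 / _.
have bE : b = 3 / (4 * pi * n%:R ^+ 2) * (sin (pi * x) ^+ 2)^-1.
  by rewrite /b (invfM (4 * pi * n%:R ^+ 2)) mulrA.
have b1 : saw_barrier n 1 x <= b.
  rewrite /saw_barrier bE ler_pM2r ?invr_gt0 ?exprn_gt0//.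
  rewrite ler_pM2r ?invr_gt0//.
  by move: (sin_le1 (2 * pi * n%:R * x)); move: (sin _) => t; lra.
have b2 : - b <= saw_barrier n (-1) x.
  rewrite /saw_barrier bE -!mulNr ler_pM2r ?invr_gt0 ?exprn_gt0//.
  rewrite ler_pM2r ?invr_gt0//.
  by move: (sin_geN1 (2 * pi * n%:R * x)); move: (sin _) => t; lra.
have : 0 < (4 * pi * n%:R ^+ 2 : R)^-1 by rewrite invr_gt0.
rewrite mulN1r mul1r opprK; move: b {bE} b1 b2 (_^-1) (saw_err n x) => b.
move: (saw_barrier n 1 x) (saw_barrier n (-1) x) => u v b1 b2 w e w0 h1 h2.
by rewrite ler_norml; apply/andP; split; lra.
Qed.

(** Each of the fewer than n terms of the Riesz mean is at most |sin (pi x)|. *)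
Lemma saw_err_near (R : realType) (n : nat) (x : R) :
  (0 < n)%N -> 0 <= x <= 1 / 2 -> n%:R * `|sin (pi * x)| <= 1 ->
  `|saw_err n x| <= 3 / 2.
Proof.
move=> n0 /andP[x0 x2] nS.
have s1 : `|riesz_saw n x| <= 1.
  rewrite (le_trans _ nS)// (le_trans (ler_norm_sum _ _ _))//.
  apply: (@le_trans _ _ (\sum_(1 <= k < n) `|sin (pi * x)|)).
    rewrite big_nat_cond [leRHS]big_nat_cond; apply: ler_sum => k /andP[/andP[k1 kn] _].
    have k0 : 0 < (k%:R : R) by rewrite ltr0n.
    have nn : 0 < (n%:R : R) by rewrite ltr0n.
    have := norm_sin_natmul_le R (2 * k)%N (pi * x).
    have -> : (2 * k)%:R * (pi * x) = 2 * pi * k%:R * x by rewrite natrM; ring.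
    rewrite normrM natrM => h.
    have c0 : 0 <= riesz_coef n k :> R.
      rewrite /riesz_coef divr_ge0 ?mulr_ge0 ?pi_ge0// subr_ge0 exprn_ile1//.
      by rewrite ler_pdivrMr// mul1r ler_nat ltnW.
    have c1 : riesz_coef n k * (2 * k%:R) <= 1 :> R.
      rewrite /riesz_coef mulrAC ler_pdivrMr ?mulr_gt0 ?pi_gt0// mul1r.
      rewrite (@le_trans _ _ (2 * k%:R))//.
        by rewrite ler_piMl ?mulr_ge0// gerBl sqr_ge0.
      by rewrite ler_wpM2r// pi_ge2.
    rewrite (ger0_norm c0) (le_trans (ler_wpM2l c0 h))// mulrA.
    by rewrite ler_piMl.
  rewrite sumr_const_nat -[leLHS]mulr_natl ler_wpM2r// ler_nat; exact: leq_subr.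
rewrite /saw_err; move: s1; move: (riesz_saw n x) => u.
by rewrite !ler_norml => /andP[u1 u2]; apply/andP; split; lra.
Qed.

Lemma sin_le_id (R : realType) (x : R) : 0 <= x -> sin x <= x.
Proof.
move=> x0.
have dg (y : R) : 0 <= y <= x -> is_derive y 1 (fun y => y - sin y) (1 - cos y).
  by move=> _; have := is_deriveB (is_derive_id y 1) (is_derive_sin y).
have dg0 (y : R) : 0 <= y <= x -> 0 <= 1 - cos y by rewrite subr_ge0 cos_le1.
have := @le_of_nonneg_derive R _ _ 0 x x0 dg dg0.
by rewrite sin0 subrr subr_ge0.
Qed.

(** Two Fejer kernels, shifted by half a zero spacing so that the numerators
    sin ^ 2 and cos ^ 2 of their closed forms do not vanish together. *)
Definition saw_major {R : realType} (n : nat) (x : R) : R :=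
  16 / n%:R ^+ 2 * (fejer n (pi * x) + fejer n (pi * x + pi / (2 * n%:R))).

(** Both squared sines in the denominators are below (|sin (pi x)| + 2 / n) ^ 2,
    and the numerators add up to sin ^ 2 + cos ^ 2 = 1. *)
Lemma saw_major_ge (R : realType) (n : nat) (x : R) : (0 < n)%N ->
  16 / (n%:R * `|sin (pi * x)| + 2) ^+ 2 <= saw_major n x.
Proof.
move=> n0; have nn : 0 < (n%:R : R) by rewrite ltr0n.
set S := `|sin (pi * x)|; have S0 : 0 <= S by exact: normr_ge0.
pose d : R := pi / (2 * n%:R).
have d0 : 0 <= d by rewrite divr_ge0 ?pi_ge0// mulr_ge0.
have d2 : d <= 2 / n%:R.
  rewrite ler_pdivrMr ?mulr_gt0//.
  have -> : 2 / n%:R * (2 * n%:R) = 4 :> R.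
    by rewrite mulrACA mulVf ?gt_eqF//; lra.
  by have := ltW (@pihalf_lt2 R); rewrite ler_pdivrMr//; move: (pi : R) => p; lra.
pose B := (S + 2 / n%:R) ^+ 2.
have sd : `|sin (pi * x + d)| <= S + 2 / n%:R.
  rewrite sinD (le_trans (ler_normD _ _))// lerD//.
    by rewrite normrM ler_piMr// cos_max.
  rewrite normrM (@le_trans _ _ `|sin d|)//; first by rewrite ler_piMl// cos_max.
  have [ds|ds] := lerP 0 (sin d).
    by rewrite (ger0_norm ds) (le_trans _ d2)// sin_le_id.
  rewrite (ltr0_norm ds) (le_trans _ d2)//; have : - sin d <= 1 by rewrite -sinN sin_le1.
  move: ds; case: (lerP d pi) => [dpi|dpi].
    by rewrite ltNge sin_ge0_pi// d0.
  move=> _ h; rewrite (le_trans h)// ltW// (lt_trans _ dpi)//.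
  by have := @pi_ge2 R; move: (pi : R) => p; lra.
have B1 : sin (pi * x) ^+ 2 <= B.
  by rewrite -real_normK ?num_real// lerXn2r ?nnegrE ?addr_ge0 ?divr_ge0// lerDl divr_ge0.
have B2 : sin (pi * x + d) ^+ 2 <= B.
  by rewrite -real_normK ?num_real// lerXn2r ?nnegrE ?addr_ge0 ?divr_ge0.
have key : 1 <= (fejer n (pi * x) + fejer n (pi * x + d)) * B.
  rewrite mulrDl (@le_trans _ _ (fejer n (pi * x) * sin (pi * x) ^+ 2 +
     fejer n (pi * x + d) * sin (pi * x + d) ^+ 2))//; last first.
    by rewrite lerD// ler_wpM2l// fejer_ge0.
  rewrite !fejer_closed mulrDr.
  have -> : n%:R * d = pi / 2.
    rewrite /d; move: (pi : R) => p; field; rewrite ?gt_eqF//.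
  by rewrite sinDpihalf addrC cos2Dsin2.
have -> : 16 / (n%:R * S + 2) ^+ 2 = 16 / n%:R ^+ 2 / B.
  rewrite /B -mulrA -invfM -exprMn mulrDr mulrCA divff ?gt_eqF// mulr1//.
have Bp : 0 < B by rewrite exprn_gt0// ltr_wpDl// divr_gt0.
rewrite /saw_major ler_pdivrMr// -[leRHS]mulrA ler_peMr//.
Qed.

(** The far and near bounds together are dominated by the lower bound for the
    majorant. The majorant is a trigonometric polynomial of degree less than n with
    mean 32 / n, and it is this pair of properties that makes it useful. *)
Lemma saw_err_le_major (R : realType) (n : nat) (x : R) :
  (0 < n)%N -> 0 <= x <= 1 -> `|saw_err n x| <= saw_major n x.
Proof.
move=> n0 x01; apply: le_trans (saw_major_ge _ _ x n0).
wlog xh : x x01 / x <= 1 / 2.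
  move=> W; have [h|/ltW h] := lerP x (1 / 2); first exact: W.
  have := W (1 - x); rewrite saw_err_onem normrN.
  have -> : pi * (1 - x) = - (pi * x - pi) by ring.
  rewrite sinN normrN.
  have -> : sin (pi * x - pi) = - sin (pi * x) by rewrite sinB sinpi cospi; ring.
  by rewrite normrN; apply; lra.
have nn : 0 < (n%:R : R) by rewrite ltr0n.
set S := `|sin _|; have S0 : 0 <= S by exact: normr_ge0.
have d0 : 0 < (n%:R * S + 2) ^+ 2 by rewrite exprn_gt0// ltr_wpDl// mulr_ge0.
case/andP: x01 => x0 _.
have [h|h] := lerP (n%:R * S) 1.
  apply: le_trans (saw_err_near _ _ _ n0 _ h) _; first by rewrite x0 xh.
  have nS0 : 0 <= n%:R * S by rewrite mulr_ge0.
  by rewrite ler_pdivlMr//; move: nS0 h; move: (n%:R * S) => u; nra.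
have Sp : 0 < S.
  by rewrite lt_neqAle S0 andbT; apply: contraTneq h => <-; rewrite mulr0 -leNgt.
have xp : 0 < x.
  rewrite lt_neqAle x0 andbT; apply: contraTneq Sp => xE.
  by rewrite /S -xE mulr0 sin0 normr0 ltxx.
apply: le_trans (saw_err_far _ _ _ n0 _) _; first by rewrite xp xh.
rewrite -[sin _ ^+ 2]real_normK ?num_real// -/S -mulrA -exprMn.
have h2 : 0 < (n%:R * S) ^+ 2 by rewrite exprn_gt0// mulr_gt0.
rewrite ler_pdivrMr ?mulr_gt0 ?pi_gt0// mulrAC ler_pdivlMr//.
have := @pi_ge2 R; move: h; move: (n%:R * S) (pi : R) => u p u1 p2.
have h3 : (u + 2) ^+ 2 <= 9 * u ^+ 2 by nra.
apply: (@le_trans _ _ (16 * (4 * 2 * u ^+ 2))); first by lra.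
by rewrite ler_pM2l// ler_wpM2r ?sqr_ge0// ler_pM2l.
Qed.

(** * Bounded measurable functions on the torus *)

Definition mean {R : realType} (f : R -> R) : R := \int[torus_measure R]_x f x.

(** A class closed under all the operations used below, on which the mean over the
    torus is linear and monotone without further integrability conditions. *)
Definition bmeas {R : realType} (f : R -> R) : Prop :=
  measurable_fun [set: R] f /\ exists B, forall x, `|f x| <= B.

Lemma bmeas_integrable (R : realType) (f : R -> R) : bmeas f ->
  (torus_measure R).-integrable [set: R] (EFin \o f).
Proof.
move=> [mf [B fB]]; apply: measurable_bounded_integrable => //.
  by rewrite (le_lt_trans (@probability_le1 _ _ _ (torus_measure R) _ _))// ltry.
by exists B; split; [exact: num_real | move=> y By x _; exact: le_trans (fB x) (ltW By)].
Qed.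

Lemma bmeas_cst (R : realType) (c : R) : bmeas (fun=> c).
Proof. by split; [exact: measurable_cst | exists `|c|]. Qed.

Lemma bmeasD (R : realType) (f g : R -> R) :
  bmeas f -> bmeas g -> bmeas (fun x => f x + g x).
Proof.
move=> [mf [B fB]] [mg [C gC]]; split; first exact: measurable_funD.
by exists (B + C) => x; rewrite (le_trans (ler_normD _ _))// lerD.
Qed.

Lemma bmeasM (R : realType) (f g : R -> R) :
  bmeas f -> bmeas g -> bmeas (fun x => f x * g x).
Proof.
move=> [mf [B fB]] [mg [C gC]]; split; first exact: measurable_funM.
by exists (B * C) => x; rewrite normrM ler_pM.
Qed.

Lemma bmeasZ (R : realType) (c : R) (f : R -> R) : bmeas f -> bmeas (fun x => c * f x).
Proof. by move=> bf; apply: bmeasM => //; exact: bmeas_cst. Qed.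

Lemma bmeasB (R : realType) (f g : R -> R) :
  bmeas f -> bmeas g -> bmeas (fun x => f x - g x).
Proof.
move=> bf bg; have := bmeasD _ _ _ bf (bmeasZ _ (-1) _ bg).
by under eq_fun do rewrite mulN1r.
Qed.

Lemma bmeas_norm (R : realType) (f : R -> R) : bmeas f -> bmeas (fun x => `|f x|).
Proof.
move=> [mf [B fB]]; split; first exact: measurableT_comp.
by exists B => x; rewrite normr_id.
Qed.

Lemma bmeas_sum (R : realType) (f : nat -> R -> R) (r : seq nat) (Q : pred nat) :
  (forall k, bmeas (f k)) -> bmeas (fun x => \sum_(k <- r | Q k) f k x).
Proof.
move=> bf; elim: r => [|k r IH].
  by under eq_fun do rewrite big_nil; exact: bmeas_cst.
under eq_fun do rewrite big_cons; case: (Q k) => //; exact: bmeasD.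
Qed.

Lemma bmeas_indic (R : realType) (A : set R) : measurable A -> bmeas (\1_A : R -> R).
Proof.
move=> mA; split; first exact: measurable_indic.
by exists 1 => x; rewrite indicE; case: (_ \in _); rewrite ?normr1 ?normr0.
Qed.

Lemma bmeas_comp_scale (R : realType) (g : R -> R) (a : R) :
  continuous g -> (forall x, `|g x| <= 1) -> bmeas (fun x => g (a * x)).
Proof.
move=> cg g1; split; last by exists 1.
apply: continuous_measurable_fun => x.
by apply: (@continuous_comp _ _ _ (fun x => a * x) g); [exact: mulrl_continuous|exact: cg].
Qed.

Lemma bmeas_cos (R : realType) (a : R) : bmeas (fun x => cos (a * x)).
Proof. by apply: bmeas_comp_scale; [exact: continuous_cos | exact: cos_max]. Qed.

Lemma bmeas_sin (R : realType) (a : R) : bmeas (fun x => sin (a * x)).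
Proof. by apply: bmeas_comp_scale; [exact: continuous_sin | exact: sin_max]. Qed.

Lemma bmeas_indic_itv (R : realType) (i : interval R) : bmeas (\1_[set` i] : R -> R).
Proof. by apply: bmeas_indic; exact: measurable_itv. Qed.

Lemma bmeas_id_unit (R : realType) : bmeas (fun y : R => y * \1_(`[0, 1]%classic) y).
Proof.
split; first by apply: measurable_funM => //; exact: measurable_indic.
exists 1 => x; rewrite indicE; case: (boolP (x \in _)); rewrite ?mulr0 ?normr0//.
by rewrite inE/= in_itv/= mulr1 => /andP[x0 x1]; rewrite ger0_norm.
Qed.

Lemma periodic_fracE (R : realType) (f : R -> R) (x : R) : periodic f 1 ->
  exists y, 0 <= y < 1 /\ f x = f y.
Proof.
move=> pf; exists (x - (Num.floor x)%:~R); split.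
  by rewrite subr_ge0 floor_le_tmp/= ltrBlDl -intrD1 floorD1_gt.
have fn n y : f (y + n%:R) = f y by rewrite -(periodicn pf n y).
case: (Num.floor x) => n.
  by rewrite -(fn n (x - _)) subrK.
by rewrite NegzE mulrNz opprK fn.
Qed.

Lemma bmeas_torus (R : realType) (phi : R -> R) : torus_continuous phi -> bmeas phi.
Proof.
move=> [cf pf]; split; first exact: continuous_measurable_fun.
have [|u _ Hu] := @EVT_max R (fun x => `|phi x|) 0 1 ler01.
  by apply: continuous_subspaceT => x; apply: cvg_norm; exact: cf.
exists `|phi u| => x; have [y [/andP[y0 y1] ->]] := periodic_fracE _ _ x pf.
by apply: Hu; rewrite in_itv/= y0 ltW.
Qed.

Lemma mean_cst (R : realType) (c : R) : mean (fun=> c) = c.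
Proof.
by rewrite /mean Rintegral_cst// [X in fine X](@probability_setT _ _ _ (torus_measure R)) mulr1.
Qed.

Lemma meanD (R : realType) (f g : R -> R) : bmeas f -> bmeas g ->
  mean (fun x => f x + g x) = mean f + mean g.
Proof. by move=> bf bg; apply: RintegralD => //; exact: bmeas_integrable. Qed.

Lemma meanB (R : realType) (f g : R -> R) : bmeas f -> bmeas g ->
  mean (fun x => f x - g x) = mean f - mean g.
Proof. by move=> bf bg; apply: RintegralB => //; exact: bmeas_integrable. Qed.

Lemma meanZ (R : realType) (c : R) (f : R -> R) : bmeas f ->
  mean (fun x => c * f x) = c * mean f.
Proof. by move=> bf; apply: RintegralZl => //; exact: bmeas_integrable. Qed.

Lemma mean_sum (R : realType) (f : nat -> R -> R) (r : seq nat) (Q : pred nat) :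
  (forall k, bmeas (f k)) ->
  mean (fun x => \sum_(k <- r | Q k) f k x) = \sum_(k <- r | Q k) mean (f k).
Proof.
move=> bf; elim: r => [|k r IH].
  by rewrite big_nil; under eq_fun do rewrite big_nil; exact: mean_cst.
rewrite big_cons; under eq_fun do rewrite big_cons.
by case: (Q k) => //; rewrite meanD// ?IH//; exact: bmeas_sum.
Qed.

Lemma le_mean (R : realType) (f g : R -> R) : bmeas f -> bmeas g ->
  (forall x, f x <= g x) -> mean f <= mean g.
Proof. by move=> bf bg fg; apply: le_Rintegral => //; exact: bmeas_integrable. Qed.

Lemma mean_ge0 (R : realType) (f : R -> R) : (forall x, 0 <= f x) -> 0 <= mean f.
Proof. by move=> f0; apply: Rintegral_ge0. Qed.

Lemma norm_mean_le (R : realType) (f : R -> R) : bmeas f ->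
  `|mean f| <= mean (fun x => `|f x|).
Proof. by move=> bf; apply: le_normr_Rintegral => //; exact: bmeas_integrable. Qed.

(** The change of measure is available for nonnegative functions; a bounded
    function becomes nonnegative after adding a constant. *)
Lemma mean_lebesgue (R : realType) (f : R -> R) : bmeas f ->
  mean f = \int[@lebesgue_measure R]_(x in `[0, 1]) f x.
Proof.
move=> bf; have [mf [B fB]] := bf.
have i1 (g : R -> R) : bmeas g ->
    (@lebesgue_measure R).-integrable `[0, 1] (EFin \o g).
  move=> [mg [C gC]]; apply: measurable_bounded_integrable => //.
  - by rewrite /= lebesgue_measure_itv/= lte01 oppr0 adde0 ltry.
  - exact: measurable_funTS.
  - by exists C; split; [exact: num_real | move=> y Cy x _; exact: le_trans (gC x) (ltW Cy)].
have bB := bmeas_cst R B.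
have e : mean (fun x => f x + B) = \int[@lebesgue_measure R]_(x in `[0, 1]) (f x + B).
  rewrite /mean /Rintegral /torus_measure integral_uniform.
  - by rewrite subr0 invr1 mul1e.
  - by apply/measurable_EFinP; have [] := bmeasD _ _ _ bf bB.
  - by move=> x; rewrite lee_fin -lerBlDr sub0r; have := fB x; rewrite ler_norml => /andP[].
move: e; rewrite meanD// mean_cst RintegralD//; [|exact: i1 ..].
rewrite Rintegral_cst//= lebesgue_measure_itv/= lte01 oppr0 adde0 mulr1.
exact: addIr.
Qed.

Lemma eq_mean (R : realType) (f g : R -> R) : bmeas f -> bmeas g ->
  (forall x, 0 <= x <= 1 -> f x = g x) -> mean f = mean g.
Proof.
move=> bf bg fg; rewrite !mean_lebesgue//; apply: eq_Rintegral => x.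
by rewrite inE/= in_itv/= => /fg.
Qed.

Lemma integral_unit_FTC (R : realType) (f F : R -> R) :
  continuous f -> (forall x : R, is_derive x 1 F (f x)) ->
  \int[@lebesgue_measure R]_(x in `[0, 1]) f x = F 1 - F 0.
Proof.
move=> cf dF; rewrite /Rintegral (@continuous_FTC2 R f F 0 1 ltr01)//.
- exact: continuous_subspaceT.
- have cF : continuous F.
    by move=> x; apply/differentiable_continuous/derivable1_diffP; have [] := dF x.
  split; first by move=> x _; have [] := dF x.
  + by apply: cvg_at_right_filter; exact: cF.
  + by apply: cvg_at_left_filter; exact: cF.
- by move=> x _; rewrite derive1E; have [_ ->] := dF x.
Qed.

Lemma mean_cos (R : realType) (k : nat) : (0 < k)%N ->
  mean (fun x : R => cos (2 * pi * k%:R * x)) = 0.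
Proof.
move=> k0; set a : R := 2 * pi * k%:R.
have a0 : a != 0 by rewrite gt_eqF// !mulr_gt0 ?pi_gt0// ltr0n.
have b := bmeas_cos R a.
have cf : continuous (fun x : R => cos (a * x)).
  move=> x; apply: (@continuous_comp _ _ _ ( *%R a) cos).
    exact: mulrl_continuous.
  exact: continuous_cos.
have dF (x : R) : is_derive x 1 (fun x => a^-1 * sin (a * x)) (cos (a * x)).
  apply: is_derive_eq (is_deriveZ a^-1 (is_derive_scaled_sin R a x)) _.
  by rewrite /GRing.scale/= mulrA mulVf// mul1r.
rewrite mean_lebesgue// (integral_unit_FTC _ _ _ cf dF).
by rewrite mulr1 mulr0 sin0 mulr0 subr0 sin_2pi_nat mulr0.
Qed.

Lemma mean_sin (R : realType) (k : nat) :
  mean (fun x : R => sin (2 * pi * k%:R * x)) = 0.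
Proof.
case: (posnP k) => [->|k0].
  by under eq_fun do rewrite mulr0 mul0r sin0; rewrite mean_cst.
set a : R := 2 * pi * k%:R.
have a0 : a != 0 by rewrite gt_eqF// !mulr_gt0 ?pi_gt0// ltr0n.
have b := bmeas_sin R a.
have cf : continuous (fun x : R => sin (a * x)).
  move=> x; apply: (@continuous_comp _ _ _ ( *%R a) sin).
    exact: mulrl_continuous.
  exact: continuous_sin.
have dF (x : R) : is_derive x 1 (fun x => - a^-1 * cos (a * x)) (sin (a * x)).
  apply: is_derive_eq (is_deriveZ (- a^-1) (is_derive_scaled_cos R a x)) _.
  by rewrite /GRing.scale/= mulrNN mulrA mulVf// mul1r.
rewrite mean_lebesgue// (integral_unit_FTC _ _ _ cf dF).
by rewrite mulr1 mulr0 cos0 cos_2pi_nat subrr.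
Qed.

Lemma mean_itv (R : realType) (a b : R) (s t : bool) : 0 <= a -> a <= b -> b <= 1 ->
  mean (\1_[set` Interval (BSide s a) (BSide t b)] : R -> R) = b - a.
Proof.
move=> a0 ab b1; set A := [set` _].
have mA : measurable A by exact: measurable_itv.
rewrite mean_lebesgue; last exact: bmeas_indic.
rewrite /Rintegral integral_indic// setIidl; last first.
  move=> x; rewrite /A/= !in_itv/=; case: s t {A mA} => [] []/= /andP[ax xb];
  by rewrite ?(le_trans a0) ?(le_trans _ b1) ?(ltW ax) ?(ltW xb).
rewrite -[LHS]/(fine (@lebesgue_measure R A)) /A lebesgue_measure_itv/= lte_fin.
have [//|ba] := ltrP a b.
by apply/esym/eqP; rewrite subr_eq0 eq_le ba ab.
Qed.

Lemma mean_id (R : realType) : mean (fun y : R => y * \1_(`[0, 1]%classic) y) = 1 / 2.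
Proof.
have b := bmeas_id_unit R.
rewrite mean_lebesgue//.
transitivity (\int[@lebesgue_measure R]_(x in `[0, 1]) x).
  by apply: eq_Rintegral => x x01; rewrite indicE x01 mulr1.
have cf : continuous (id : R -> R) by move=> x; exact: cvg_id.
have dF (x : R) : is_derive x 1 (fun x : R => x ^+ 2 / 2) x.
  have h := is_deriveX 2 (is_derive_id x (1 : R)).
  have -> : (fun x : R => x ^+ 2 / 2) = (2^-1 \*: (id ^+ 2)).
    by apply/funext => y; rewrite mulrC.
  apply: is_derive_eq (is_deriveZ 2^-1 h) _.
  by rewrite /GRing.scale/= expr1 mulr1 mulrA mulVf// mul1r.
by rewrite (integral_unit_FTC _ _ _ cf dF) expr1n expr0n/= mul0r subr0.
Qed.

(** * Harmonics and a weak Hausdorff-Young inequality *)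

Definition harmonic {R : realType} (k : nat) (a b x : R) : R :=
  a * cos (2 * pi * k%:R * x) + b * sin (2 * pi * k%:R * x).

Lemma bmeas_harmonic (R : realType) (k : nat) (a b : R) : bmeas (harmonic k a b).
Proof.
by apply: bmeasD; apply: bmeasZ; [exact: bmeas_cos | exact: bmeas_sin].
Qed.

Lemma mean_harmonic (R : realType) (k : nat) (a b : R) : (0 < k)%N ->
  mean (harmonic k a b) = 0.
Proof.
move=> k0.
have bc := bmeas_cos R (2 * pi * k%:R).
have bs := bmeas_sin R (2 * pi * k%:R).
rewrite meanD; [|exact: bmeasZ ..].
by rewrite !meanZ// mean_cos// mean_sin !mulr0 addr0.
Qed.

Lemma harmonicM (R : realType) (k l : nat) (a b c d x : R) : (k < l)%N ->
  harmonic k a b x * harmonic l c d x =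
  harmonic (l - k) ((a * c + b * d) / 2) ((a * d - b * c) / 2) x +
  harmonic (l + k) ((a * c - b * d) / 2) ((a * d + b * c) / 2) x.
Proof.
move=> kl; rewrite /harmonic (natrB _ (ltnW kl)) (natrD _ l k).
have -> : 2 * pi * (l%:R - k%:R) * x = 2 * pi * l%:R * x - 2 * pi * k%:R * x.
  by rewrite mulrBr mulrBl.
have -> : 2 * pi * (l%:R + k%:R) * x = 2 * pi * l%:R * x + 2 * pi * k%:R * x.
  by rewrite mulrDr mulrDl.
move: (2 * pi * k%:R * x) (2 * pi * l%:R * x) => A B.
rewrite cosB cosD sinB sinD.
by move: (cos A) (sin A) (cos B) (sin B) => u v w z; field.
Qed.

Lemma mean_harmonicM (R : realType) (k l : nat) (a b c d : R) :
  (0 < k)%N -> (k < l)%N ->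
  mean (fun x => harmonic k a b x * harmonic l c d x) = 0.
Proof.
move=> k0 kl; under eq_fun do rewrite harmonicM//.
rewrite meanD; [|exact: bmeas_harmonic ..].
by rewrite !mean_harmonic ?addr0// ?subn_gt0// addn_gt0 k0 orbT.
Qed.

Lemma sqr_harmonic_le (R : realType) (k : nat) (a b x : R) :
  harmonic k a b x ^+ 2 <= a ^+ 2 + b ^+ 2.
Proof.
rewrite /harmonic; have := cos2Dsin2 (2 * pi * k%:R * x).
move: (cos _) (sin _) => u v h.
have -> : a ^+ 2 + b ^+ 2 = (a ^+ 2 + b ^+ 2) * (u ^+ 2 + v ^+ 2) by rewrite h mulr1.
rewrite -subr_ge0.
have -> : (a ^+ 2 + b ^+ 2) * (u ^+ 2 + v ^+ 2) - (a * u + b * v) ^+ 2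
  = (a * v - b * u) ^+ 2 by ring.
exact: sqr_ge0.
Qed.

(** Parseval: distinct harmonics are orthogonal. *)
Lemma mean_sqr_trig_le (R : realType) (Q : pred nat) (a b : nat -> R) (n : nat) :
  mean (fun x => (\sum_(1 <= k < n | Q k) harmonic k (a k) (b k) x) ^+ 2) <=
  \sum_(1 <= k < n | Q k) (a k ^+ 2 + b k ^+ 2).
Proof.
elim: n => [|n IH].
  rewrite big_geq//; under eq_fun do rewrite big_geq// expr0n/=.
  by rewrite mean_cst.
case: n IH => [_|n IH].
  rewrite big_geq//; under eq_fun do rewrite big_geq// expr0n/=.
  by rewrite mean_cst.
rewrite big_mkcond (big_nat_recr n.+1)//= -big_mkcond/=.
under eq_fun do rewrite big_mkcond (big_nat_recr n.+1)//= -big_mkcond/=.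
case: ifPn => Qn; last first.
  by rewrite addr0; under eq_fun do rewrite addr0.
set P := fun x => \sum_(1 <= k < n.+1 | Q k) harmonic k (a k) (b k) x.
set h := harmonic n.+1 (a n.+1) (b n.+1).
have bh : bmeas h by exact: bmeas_harmonic.
have bP : bmeas P by apply: bmeas_sum => k; exact: bmeas_harmonic.
have -> : (fun x => (P x + h x) ^+ 2) =
  (fun x => (P x * P x + 2 * (P x * h x)) + h x * h x) by apply/funext => x; ring.
rewrite meanD; [|apply: bmeasD|exact: bmeasM]; [|exact: bmeasM|apply: bmeasZ; exact: bmeasM].
rewrite meanD; [|exact: bmeasM|apply: bmeasZ; exact: bmeasM].
have -> : mean (fun x => 2 * (P x * h x)) = 0.
  rewrite meanZ; last exact: bmeasM.
  have -> : (fun x => P x * h x) = (fun x => \sum_(1 <= k < n.+1 | Q k)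
      (harmonic k (a k) (b k) x * h x)).
    by apply/funext => x; rewrite mulr_suml.
  rewrite mean_sum; last by move=> k; apply: bmeasM => //; exact: bmeas_harmonic.
  rewrite big_nat_cond big1 ?mulr0// => k /andP[/andP[k1 kn] _].
  exact: mean_harmonicM.
rewrite addr0 lerD//.
rewrite -[leRHS]mean_cst; apply: le_mean => [||x].
- exact: bmeasM.
- exact: bmeas_cst.
- by rewrite -expr2 sqr_harmonic_le.
Qed.

Lemma norm_harmonic_le (R : realType) (k : nat) (a b x r : R) : 0 <= r ->
  a ^+ 2 + b ^+ 2 <= r ^+ 2 -> `|harmonic k a b x| <= r.
Proof.
move=> r0 h; rewrite -(@ler_pXn2r _ 2)// ?nnegrE//.
by rewrite real_normK ?num_real// (le_trans (sqr_harmonic_le _ _ _ _ _)).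
Qed.

(** Normalised amplitudes above the threshold w ^ (s - 1): one power of r is traded
    against r ^ s', and the choice of the threshold makes the loss exactly w. *)
Lemma large_le_powR (R : realType) (s s' r w : R) :
  1 < s -> (s - 1) * (s' - 1) = 1 -> 0 < w -> w `^ (s - 1) < r ->
  r <= r `^ s' / w.
Proof.
move=> s1 ss' w0 wr; have r0 : 0 < r by rewrite (le_lt_trans _ wr)// powR_ge0.
have s'1 : 0 < s' - 1 by rewrite -(pmulr_rgt0 _ (_ : 0 < s - 1)) ?subr_gt0// ss'.
have s'0 : 0 < s' by lra.
rewrite ler_pdivlMr// -(mulr_powRB1 (ltW r0) s'0) ler_pM2l//.
have -> : w = (w `^ (s - 1)) `^ (s' - 1) by rewrite -powRrM ss' powRr1// ltW.
by rewrite ge0_ler_powR ?nnegrE ?powR_ge0// ltW.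
Qed.

(** Amplitudes below the same threshold: two powers of r are traded against
    r ^ s', which is possible because s' <= 2. *)
Lemma sqr_small_le_powR (R : realType) (s s' r w : R) :
  2 <= s -> (s - 1) * (s' - 1) = 1 -> 0 < w -> 0 <= r -> r <= w `^ (s - 1) ->
  r ^+ 2 <= r `^ s' * w `^ (s - 2).
Proof.
move=> s2 ss' w0; rewrite le_eqVlt => /predU1P[<- _|r0 rw].
  by rewrite expr0n/= mulr_ge0 ?powR_ge0.
have e : (s - 1) * (2 - s') = s - 2 by rewrite -[in RHS]ss'; lra.
have s'2 : 0 <= 2 - s'.
  by rewrite -(pmulr_rge0 _ (_ : 0 < s - 1)) ?e ?subr_ge0//; lra.
have -> : r ^+ 2 = r `^ s' * r `^ (2 - s').
  by rewrite -powRD ?(gt_eqF r0) ?implybT// (addrC s') subrK powR_mulrn// ltW.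
rewrite ler_pM2l ?powR_gt0// -e powRrM.
by rewrite ge0_ler_powR ?nnegrE ?powR_ge0// ltW.
Qed.

(** A weak-type Hausdorff-Young inequality. Frequencies with large amplitude add up
    to at most lam / 2 uniformly, so the remaining ones reach lam / 2 on A, and
    Parseval with Chebyshev bounds the measure of A. The threshold between large and
    small is chosen to balance the two parts. *)
Lemma weak_hausdorff_young (R : realType) (s s' : R) (n : nat)
    (a b rho : nat -> R) (X lam : R) (A : set R) :
  2 <= s -> (s - 1) * (s' - 1) = 1 -> 0 < X -> 0 < lam ->
  (forall k, 0 <= rho k) ->
  (forall k, (0 < k < n)%N -> a k ^+ 2 + b k ^+ 2 <= rho k ^+ 2) ->
  \sum_(1 <= k < n) rho k `^ s' <= X `^ s' ->
  measurable A ->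
  (forall x, A x -> lam <= `|\sum_(1 <= k < n) harmonic k (a k) (b k) x|) ->
  mean (\1_A : R -> R) <= (2 * X / lam) `^ s.
Proof.
move=> s2 ss' X0 l0 rho0 abr hX mA hA.
have s10 : 0 < s - 1 by lra.
set w := 2 * X / lam; have w0 : 0 < w by rewrite divr_gt0 ?mulr_gt0.
pose r k := rho k / X.
have r0 k : 0 <= r k by rewrite divr_ge0// ltW.
have rho_r k : rho k = X * r k by rewrite mulrC divfK// gt_eqF.
have hr : \sum_(1 <= k < n) r k `^ s' <= 1.
  rewrite (_ : 1 = X `^ s' / X `^ s'); last by rewrite divff// gt_eqF// powR_gt0.
  rewrite ler_pdivlMr ?powR_gt0// mulr_suml (le_trans _ hX)//.
  apply: ler_sum => k _; rewrite -(powRM _ (r0 k) (ltW X0)).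
  by rewrite mulrC -rho_r.
pose large k := w `^ (s - 1) < r k.
pose small k := ~~ large k.
pose P x := \sum_(1 <= k < n | small k) harmonic k (a k) (b k) x.
have bP : bmeas P.
  by apply: (bmeas_sum R (fun k => harmonic k (a k) (b k))) => j; exact: bmeas_harmonic.
have sub (Q : pred nat) : \sum_(1 <= k < n | Q k) r k `^ s' <= 1.
  apply: le_trans hr; rewrite [leLHS]big_mkcond; apply: ler_sum => k _.
  by case: ifP => // _; rewrite powR_ge0.
have hlarge : \sum_(1 <= k < n | large k) rho k <= lam / 2.
  apply: (@le_trans _ _ (\sum_(1 <= k < n | large k) X * (r k `^ s' / w))).
    apply: ler_sum => k lk; rewrite rho_r ler_pM2l//.
    by apply: (large_le_powR _ _ _ _ _ _ ss' w0 lk); lra.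
  rewrite -mulr_sumr -mulr_suml.
  have -> : lam / 2 = X * (1 / w).
    by rewrite /w; field; rewrite !gt_eqF.
  by rewrite ler_pM2l// ler_pM2r ?invr_gt0.
have hsmall : \sum_(1 <= k < n | small k) (a k ^+ 2 + b k ^+ 2) <= X ^+ 2 * w `^ (s - 2).
  apply: (@le_trans _ _ (\sum_(1 <= k < n | small k) X ^+ 2 * (r k `^ s' * w `^ (s - 2)))).
    rewrite big_nat_cond [leRHS]big_nat_cond.
    apply: ler_sum => k /andP[kn]; rewrite /small /large -leNgt => sk.
    rewrite (le_trans (abr k kn))// rho_r exprMn ler_pM2l ?exprn_gt0//.
    exact: (sqr_small_le_powR _ s).
  rewrite -mulr_sumr -mulr_suml ler_pM2l ?exprn_gt0//.
  by rewrite ler_piMl ?powR_ge0.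
have pt x : (lam / 2) ^+ 2 * (\1_A : R -> R) x <= P x * P x.
  rewrite indicE; case: (boolP (x \in A)) => [|_]; last first.
    by rewrite mulr0 -expr2 sqr_ge0.
  rewrite inE mulr1 => /hA lx; rewrite -expr2 -[leRHS]real_normK ?num_real//.
  have l20 : 0 <= lam / 2 by rewrite divr_ge0// ltW.
  rewrite ler_pXn2r ?nnegrE//.
  have e : \sum_(1 <= k < n) harmonic k (a k) (b k) x =
     \sum_(1 <= k < n | large k) harmonic k (a k) (b k) x + P x.
    by rewrite (bigID large).
  have hL : `|\sum_(1 <= k < n | large k) harmonic k (a k) (b k) x| <= lam / 2.
    apply: le_trans hlarge; apply: le_trans (ler_norm_sum _ _ _) _.
    rewrite big_nat_cond [leRHS]big_nat_cond.
    by apply: ler_sum => k /andP[kn _]; apply: norm_harmonic_le => //; exact: abr.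
  rewrite e in lx; have := le_trans lx (ler_normD _ _).
  rewrite -lerBlDl; apply: le_trans.
  by rewrite lerBrDr [leRHS]splitr lerD2l.
have bA : bmeas (\1_A : R -> R) by exact: bmeas_indic.
have h1 : (lam / 2) ^+ 2 * mean (\1_A : R -> R) <= X ^+ 2 * w `^ (s - 2).
  rewrite -meanZ//; apply: le_trans hsmall; apply: le_trans (mean_sqr_trig_le _ _ _ _ _).
  apply: le_mean => [||x]; [exact: bmeasZ|exact: bmeasM|].
  by rewrite expr2; exact: pt.
have -> : w `^ s = w ^+ 2 * w `^ (s - 2).
  rewrite -powR_mulrn ?ltW// -powRD; last by rewrite (gt_eqF w0) implybT.
  by rewrite addrC subrK.
have l2 : 0 < (lam / 2) ^+ 2 by rewrite exprn_gt0// divr_gt0.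
rewrite -(ler_pM2l l2) (le_trans h1)// mulrA ler_pM2r ?powR_gt0//.
have -> : (lam / 2) ^+ 2 * w ^+ 2 = X ^+ 2; last by [].
by rewrite -exprMn; congr (_ ^+ 2); rewrite /w; field; rewrite gt_eqF.
Qed.

(** * The sawtooth against its trigonometric majorant *)

Lemma le_mean_unit (R : realType) (f g : R -> R) : bmeas f -> bmeas g ->
  (forall x, 0 <= x <= 1 -> f x <= g x) -> mean f <= mean g.
Proof.
move=> bf bg fg.
have m01 : measurable (`[0, 1]%classic : set R) by exact: measurable_itv.
have bi := bmeas_indic R _ m01.
have e (h : R -> R) : bmeas h -> mean h = mean (fun x => h x * \1_(`[0, 1]%classic) x).
  move=> bh; apply: eq_mean => //; first exact: bmeasM.
  by move=> x x01; rewrite indicE mem_set ?mulr1//= in_itv.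
rewrite e// [leRHS]e//; apply: le_mean => [||x]; [exact: bmeasM..|].
rewrite indicE; case: (boolP (x \in _)); rewrite ?mulr0// !mulr1.
by rewrite inE/= in_itv/= => /fg.
Qed.

(** On [0, 1]^2 this is the periodic sawtooth at x - y. The indicator of [0, 1]
    keeps the function of y bounded on the whole line. *)
Definition sawtooth {R : realType} (x y : R) : R :=
  \1_(`[0, x[%classic) y + y * \1_(`[0, 1]%classic) y - (x + 1 / 2).

Lemma bmeas_sawtooth (R : realType) (x : R) : bmeas (sawtooth x).
Proof.
apply: bmeasB; last exact: bmeas_cst.
by apply: bmeasD; [exact: bmeas_indic_itv | exact: bmeas_id_unit].
Qed.

Lemma mean_sawtooth (R : realType) (x : R) : 0 <= x <= 1 -> mean (sawtooth x) = 0.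
Proof.
move=> /andP[x0 x1]; have b1 := bmeas_indic_itv R `[0, x[; have b2 := bmeas_id_unit R.
have -> : mean (sawtooth x) = mean (fun y => \1_(`[0, x[%classic) y +
    y * \1_(`[0, 1]%classic) y) - mean (fun=> x + 1 / 2).
  by apply: meanB; [exact: bmeasD | exact: bmeas_cst].
rewrite mean_cst meanD// mean_id mean_itv//; lra.
Qed.

Lemma harmonicD1 (R : realType) (k : nat) (a b x : R) :
  harmonic k a b (x + 1) = harmonic k a b x.
Proof.
by rewrite /harmonic mulrDr mulr1 cosD sinD cos_2pi_nat sin_2pi_nat !mulr1 !mulr0 subr0 addr0.
Qed.

Lemma riesz_saw_harmonic (R : realType) (n : nat) (x : R) :
  riesz_saw n x = \sum_(1 <= k < n) harmonic k 0 (riesz_coef n k) x.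
Proof. by apply: eq_bigr => k _; rewrite /harmonic mul0r add0r. Qed.

Definition major_cos {R : realType} (n k : nat) : R :=
  32 * (n%:R - k%:R) / n%:R ^+ 2 * (1 + cos (pi * k%:R / n%:R)).

Definition major_sin {R : realType} (n k : nat) : R :=
  - (32 * (n%:R - k%:R) / n%:R ^+ 2 * sin (pi * k%:R / n%:R)).

Lemma saw_major_harmonic (R : realType) (n : nat) (x : R) : (0 < n)%N ->
  saw_major n x = 32 / n%:R +
    \sum_(1 <= k < n) harmonic k (major_cos n k) (major_sin n k) x.
Proof.
move=> n0; have nn : (n%:R : R) != 0 by rewrite pnatr_eq0 -lt0n.
rewrite /saw_major /fejer addrACA -mulrDr -big_split/= mulrDr; congr (_ + _).
  by field.
rewrite mulrA mulr_sumr; apply: eq_bigr => k _.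
have -> : 2 * k%:R * (pi * x) = 2 * pi * k%:R * x by ring.
have -> : 2 * k%:R * (pi * x + pi / (2 * n%:R)) = 2 * pi * k%:R * x + pi * k%:R / n%:R.
  by move: (pi : R) => p; field.
rewrite cosD /harmonic /major_cos /major_sin.
move: (2 * pi * k%:R * x) (pi * k%:R / n%:R) => A B.
by move: (cos A) (sin A) (cos B) (sin B) => u v w z; field.
Qed.

(** Both this bound and the next one are of the form C / k, the decay of the Fourier
    coefficients of the sawtooth. *)
Lemma riesz_coef_sqr_le (R : realType) (n k : nat) : (0 < k < n)%N ->
  (0 : R) ^+ 2 + riesz_coef n k ^+ 2 <= (64 / k%:R) ^+ 2.
Proof.
move=> /andP[k0 kn].
have kk : 0 < (k%:R : R) by rewrite ltr0n.
have nn : 0 < (n%:R : R) by rewrite ltr0n (leq_trans _ kn).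
have c0 : 0 <= riesz_coef n k :> R.
  rewrite /riesz_coef divr_ge0 ?mulr_ge0 ?pi_ge0// subr_ge0 exprn_ile1//.
  by rewrite ler_pdivrMr// mul1r ler_nat ltnW.
rewrite expr0n add0r ler_pXn2r ?nnegrE//.
rewrite /riesz_coef invfM mulrA ler_pM2r ?invr_gt0//.
rewrite ler_pdivrMr ?pi_gt0//; apply: (@le_trans _ _ 1); first by rewrite gerBl sqr_ge0.
by have := @pi_ge2 R; move: (pi : R) => p; lra.
Qed.

Lemma major_coef_sqr_le (R : realType) (n k : nat) : (0 < k < n)%N ->
  major_cos n k ^+ 2 + major_sin n k ^+ 2 <= (64 / k%:R) ^+ 2 :> R.
Proof.
move=> /andP[k0 kn].
have kk : 0 < (k%:R : R) by rewrite ltr0n.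
have nn : 0 < (n%:R : R) by rewrite ltr0n (leq_trans _ kn).
rewrite /major_cos /major_sin; set q := 32 * _ / _; set d := pi * _ / _.
have q0 : 0 <= q.
  by rewrite divr_ge0 ?exprn_ge0 ?mulr_ge0// subr_ge0 ler_nat ltnW.
have -> : (q * (1 + cos d)) ^+ 2 + (- (q * sin d)) ^+ 2 = q ^+ 2 * (2 + 2 * cos d).
  have := cos2Dsin2 d; move: (cos d) (sin d) => u v h.
  have -> : (q * (1 + u)) ^+ 2 + (- (q * v)) ^+ 2 =
     q ^+ 2 * (1 + 2 * u + (u ^+ 2 + v ^+ 2)) by ring.
  by rewrite h; ring.
apply: (@le_trans _ _ ((2 * q) ^+ 2)).
  have -> : (2 * q) ^+ 2 = q ^+ 2 * 4 by ring.
  apply: ler_wpM2l; first exact: sqr_ge0.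
  by have := cos_le1 d; move: (cos d) => u; lra.
have qk : q <= 32 / k%:R.
  apply: (@le_trans _ _ (32 / n%:R)).
    rewrite /q expr2 invfM mulrA ler_pM2r ?invr_gt0// ler_pdivrMr//.
    by rewrite ler_pM2l// gerBl.
  by rewrite ler_pM2l// lef_pV2 ?posrE// ler_nat ltnW.
have -> : 64 / k%:R = 2 * (32 / k%:R) :> R by lra.
have k32 : 0 <= 32 / k%:R :> R by rewrite divr_ge0// ltW.
have h : 2 * q <= 2 * (32 / k%:R) by rewrite ler_pM2l.
by apply: lerXn2r h; rewrite nnegrE mulr_ge0.
Qed.

(** For y < x the argument x - y lies in [0, 1]; otherwise x - y + 1 does, and the
    two trigonometric polynomials are 1-periodic. *)
Lemma sawtooth_approx (R : realType) (n : nat) (x y : R) : (0 < n)%N ->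
  0 <= x <= 1 -> 0 <= y <= 1 ->
  `|sawtooth x y - riesz_saw n (x - y)| <= saw_major n (x - y).
Proof.
move=> n0 /andP[x0 x1] /andP[y0 y1].
rewrite /sawtooth !indicE (mem_set (_ : `[0, 1]%classic y)) /=; last first.
  by rewrite in_itv/= y0.
have [yx|xy] := ltP y x.
  rewrite (mem_set (_ : `[0, x[%classic y)) /=; last by rewrite in_itv/= y0.
  have -> : 1 + y * 1 - (x + 1 / 2) - riesz_saw n (x - y) = saw_err n (x - y).
    by rewrite /saw_err; move: (riesz_saw _ _) => u; lra.
  by apply: saw_err_le_major => //; lra.
rewrite (memNset (_ : ~ `[0, x[%classic y)) /=; last first.
  by rewrite in_itv/= y0/= ltNge xy.
have e1 : riesz_saw n (x - y + 1) = riesz_saw n (x - y).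
  by rewrite !riesz_saw_harmonic; apply: eq_bigr => k _; exact: harmonicD1.
have <- : saw_major n (x - y + 1) = saw_major n (x - y).
  by rewrite !saw_major_harmonic//; congr (_ + _); apply: eq_bigr => k _; exact: harmonicD1.
have -> : 0 + y * 1 - (x + 1 / 2) - riesz_saw n (x - y) = saw_err n (x - y + 1).
  by rewrite /saw_err e1; move: (riesz_saw _ _) => u; lra.
by apply: saw_err_le_major => //; lra.
Qed.

(** * The primitive as a convolution with the sawtooth *)

Definition cos_coef {R : realType} (phi : R -> R) (k : nat) : R :=
  mean (fun x => phi x * cos (2 * pi * k%:R * x)).

Definition sin_coef {R : realType} (phi : R -> R) (k : nat) : R :=
  mean (fun x => phi x * sin (2 * pi * k%:R * x)).

Definition coef_norm {R : realType} (phi : R -> R) (k : nat) : R :=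
  Num.sqrt (cos_coef phi k ^+ 2 + sin_coef phi k ^+ 2).

Lemma harmonic_shift (R : realType) (k : nat) (a b x y : R) :
  harmonic k a b (x - y) = 
  harmonic k a b x * cos (2 * pi * k%:R * y) +
  harmonic k (- b) a x * sin (2 * pi * k%:R * y).
Proof.
rewrite /harmonic mulrBr cosB sinB.
move: (2 * pi * k%:R * x) (2 * pi * k%:R * y) => A B.
by move: (cos A) (sin A) (cos B) (sin B) => u v w z; ring.
Qed.

Lemma bmeas_harmonic_shift (R : realType) (k : nat) (a b x : R) :
  bmeas (fun y => harmonic k a b (x - y)).
Proof.
under eq_fun do rewrite harmonic_shift.
by apply: bmeasD; apply: bmeasZ; [exact: bmeas_cos | exact: bmeas_sin].
Qed.

Lemma mean_harmonic_shift (R : realType) (k : nat) (a b x : R) : (0 < k)%N ->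
  mean (fun y => harmonic k a b (x - y)) = 0.
Proof.
move=> k0; under eq_fun do rewrite harmonic_shift.
rewrite meanD; [|apply: bmeasZ; exact: bmeas_cos | apply: bmeasZ; exact: bmeas_sin].
by rewrite meanZ ?meanZ ?mean_cos ?mean_sin ?mulr0 ?addr0//; [exact: bmeas_sin|exact: bmeas_cos].
Qed.

Lemma mean_harmonic_conv (R : realType) (phi : R -> R) (k : nat) (a b x : R) : bmeas phi ->
  mean (fun y => harmonic k a b (x - y) * phi y) =
  harmonic k (a * cos_coef phi k - b * sin_coef phi k)
             (a * sin_coef phi k + b * cos_coef phi k) x.
Proof.
move=> bphi.
have bc := bmeasM _ _ _ bphi (bmeas_cos R (2 * pi * k%:R)).
have bs := bmeasM _ _ _ bphi (bmeas_sin R (2 * pi * k%:R)).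
have -> : (fun y => harmonic k a b (x - y) * phi y) =
  (fun y => harmonic k a b x * (phi y * cos (2 * pi * k%:R * y)) +
            harmonic k (- b) a x * (phi y * sin (2 * pi * k%:R * y))).
  by apply/funext => y; rewrite harmonic_shift; ring.
rewrite meanD; [|exact: bmeasZ ..].
rewrite (meanZ _ _ _ bc) (meanZ _ _ _ bs) /cos_coef /sin_coef /harmonic.
by move: (mean _) (mean _) (cos _) (sin _) => u v w z; ring.
Qed.

Lemma conv_amplitude_le (R : realType) (phi : R -> R) (k : nat) (a b r : R) : 0 <= r ->
  a ^+ 2 + b ^+ 2 <= r ^+ 2 ->
  (a * cos_coef phi k - b * sin_coef phi k) ^+ 2 +
  (a * sin_coef phi k + b * cos_coef phi k) ^+ 2 <= (r * coef_norm phi k) ^+ 2.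
Proof.
move=> r0 h; rewrite exprMn /coef_norm sqr_sqrtr ?addr_ge0 ?sqr_ge0//.
move: (cos_coef _ _) (sin_coef _ _) => c d.
have -> : (a * c - b * d) ^+ 2 + (a * d + b * c) ^+ 2 =
   (a ^+ 2 + b ^+ 2) * (c ^+ 2 + d ^+ 2) by ring.
by rewrite ler_wpM2r// addr_ge0 ?sqr_ge0.
Qed.

(** The primitive of phi, up to an additive constant, when phi has mean zero. *)
Definition prim {R : realType} (phi : R -> R) (x : R) : R :=
  mean (fun y => sawtooth x y * phi y).

Lemma primB (R : realType) (phi : R -> R) (a b : R) : bmeas phi -> mean phi = 0 ->
  0 <= a -> a <= b -> prim phi b - prim phi a = mean (fun y => \1_(`[a, b[%classic) y * phi y).
Proof.
move=> bphi phi0 a0 ab; rewrite /prim -meanB; [|by apply: bmeasM => //; exact: bmeas_sawtooth ..].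
have -> : (fun y => sawtooth b y * phi y - sawtooth a y * phi y) =
  (fun y => \1_(`[a, b[%classic) y * phi y - (b - a) * phi y).
  apply/funext => y; rewrite -mulrBl -[RHS]mulrBl; congr (_ * _).
  rewrite /sawtooth.
  have -> : (\1_(`[0, b[%classic) y : R) = \1_(`[0, a[%classic) y + \1_(`[a, b[%classic) y.
    rewrite !indicE !mem_setE !in_itv/=; case: (ltP y a) => ya /=.
      by rewrite (lt_le_trans ya ab) addr0.
    by rewrite (le_trans a0 ya) andbF add0r.
  by ring.
rewrite meanB; [|by apply: bmeasM => //; exact: bmeas_indic_itv|exact: bmeasZ].
by rewrite meanZ// phi0 mulr0 subr0.
Qed.

(** Convolution with phi and with phi + M agree on mean-zero kernels, and phi + M is
    nonnegative, so the pointwise bound of the sawtooth error by the majorant can be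
    integrated against phi + M. The constant term of the majorant meets M and gives
    32 M / n. *)
Lemma norm_prim_le (R : realType) (phi : R -> R) (M : R) (n : nat) (x : R) :
  (0 < n)%N -> bmeas phi -> mean phi = 0 ->
  {ae torus_measure R, forall y, - M <= phi y} -> 0 <= x <= 1 ->
  `|prim phi x| <=
  `|mean (fun y => riesz_saw n (x - y) * phi y)| +
  `|mean (fun y => (saw_major n (x - y) - 32 / n%:R) * phi y)| + 32 * (M / n%:R).
Proof.
move=> n0 bphi phi0 aeM x01.
have bsaw := bmeas_sawtooth R x.
have br : bmeas (fun y => riesz_saw n (x - y)).
  under eq_fun do rewrite riesz_saw_harmonic.
  by apply: bmeas_sum => k; exact: bmeas_harmonic_shift.
have bh : bmeas (fun y => \sum_(1 <= k < n) harmonic k (major_cos n k) (major_sin n k) (x - y)).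
  by apply: (bmeas_sum R (fun k y => harmonic k (major_cos n k) (major_sin n k) (x - y))) => k;
    exact: bmeas_harmonic_shift.
have bm : bmeas (fun y => saw_major n (x - y)).
  under eq_fun do rewrite saw_major_harmonic//.
  by apply: bmeasD => //; exact: bmeas_cst.
have mr : mean (fun y => riesz_saw n (x - y)) = 0.
  under eq_fun do rewrite riesz_saw_harmonic.
  rewrite mean_sum; last by move=> k; exact: bmeas_harmonic_shift.
  by rewrite big_nat_cond big1// => k /andP[/andP[k1 _] _]; exact: mean_harmonic_shift.
have mm : mean (fun y => saw_major n (x - y)) = 32 / n%:R.
  under eq_fun do rewrite saw_major_harmonic//.
  rewrite meanD; [|exact: bmeas_cst|exact: bh].
  rewrite mean_cst mean_sum; last by move=> k; exact: bmeas_harmonic_shift.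
  by rewrite big_nat_cond big1 ?addr0// => k /andP[/andP[k1 _] _]; exact: mean_harmonic_shift.
have bD := bmeasB _ _ _ bsaw br.
have bpM := bmeasD _ _ _ bphi (bmeas_cst R M).
have e1 : prim phi x - mean (fun y => riesz_saw n (x - y) * phi y) =
   mean (fun y => (sawtooth x y - riesz_saw n (x - y)) * (phi y + M)).
  rewrite /prim -meanB; [|exact: bmeasM..].
  have -> : (fun y => (sawtooth x y - riesz_saw n (x - y)) * (phi y + M)) =
    (fun y => (sawtooth x y * phi y - riesz_saw n (x - y) * phi y) +
      M * (sawtooth x y - riesz_saw n (x - y))) by apply/funext => y; ring.
  rewrite [RHS]meanD; [|by apply: bmeasB; exact: bmeasM|exact: bmeasZ].
  by rewrite meanZ// [in RHS](meanB _ _ _ bsaw br) mean_sawtooth// mr subrr mulr0 addr0.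
have e2 : mean (fun y => saw_major n (x - y) * `|phi y + M|) =
   mean (fun y => (saw_major n (x - y) - 32 / n%:R) * phi y) + 32 * (M / n%:R).
  transitivity (mean (fun y => saw_major n (x - y) * (phi y + M))).
    have b1 := bmeasM _ _ _ bm (bmeas_norm _ _ bpM).
    have b2 := bmeasM _ _ _ bm bpM.
    congr fine; apply: ae_eq_integral => //.
    - by apply/measurable_EFinP; have [] := b1.
    - by apply/measurable_EFinP; have [] := b2.
    - apply: (@filterS _ _ (ae_filter_ringOfSetsType _) _ _ _ aeM) => y My _ /=; rewrite ger0_norm//.
      by rewrite -lerBlDr sub0r.
  have -> : (fun y => saw_major n (x - y) * (phi y + M)) =
     (fun y => ((saw_major n (x - y) - 32 / n%:R) * phi y + (32 / n%:R) * phi y)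
        + M * saw_major n (x - y)) by apply/funext => y; ring.
  have bmc := bmeasB _ _ _ bm (bmeas_cst R (32 / n%:R)).
  rewrite meanD; [|by apply: bmeasD; [exact: bmeasM|exact: bmeasZ]|exact: bmeasZ].
  rewrite meanD; [|exact: bmeasM|exact: bmeasZ].
  by rewrite (meanZ _ _ _ bphi) phi0 mulr0 addr0 (meanZ _ _ _ bm) mm mulrCA.
have -> : prim phi x = mean (fun y => riesz_saw n (x - y) * phi y) +
  (prim phi x - mean (fun y => riesz_saw n (x - y) * phi y)) by rewrite addrC subrK.
rewrite -addrA (le_trans (ler_normD _ _))// lerD2l e1.
apply: (@le_trans _ _ (mean (fun y => saw_major n (x - y) * `|phi y + M|))); last first.
  by rewrite e2 lerD2r ler_norm.
apply: le_trans (norm_mean_le _ _ (bmeasM _ _ _ bD bpM)) _.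
apply: le_mean_unit => [||y y01].
- by apply: bmeas_norm; exact: bmeasM.
- by apply: bmeasM => //; exact: bmeas_norm.
- by rewrite normrM ler_wpM2r// sawtooth_approx.
Qed.

(** * Level sets of the primitive: upper bound *)

Lemma measurable_superlevel (R : realType) (f : R -> R) (c : R) : bmeas f ->
  measurable [set x : R | c <= f x].
Proof.
move=> [mf _].
have -> : [set x : R | c <= f x] = [set: R] `&` f @^-1` `[c, +oo[%classic.
  by rewrite setTI; apply/seteqP; split => x /=; rewrite in_itv/= andbT.
by apply: mf => //; exact: measurable_itv.
Qed.

Lemma mean_indic_le1 (R : realType) (A : set R) : measurable A ->
  mean (\1_A : R -> R) <= 1.
Proof.
move=> mA; rewrite -[leRHS](mean_cst R 1); apply: le_mean => [||x].
- exact: bmeas_indic.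
- exact: bmeas_cst.
- by rewrite indicE; case: (_ \in _).
Qed.

(** Convolution with phi multiplies the amplitude of the k-th harmonic by the modulus
    of the k-th Fourier coefficient. *)
Lemma conv_level_set_le (R : realType) (s s' : R) (n : nat) (phi : R -> R)
    (a b : nat -> R) (X lam : R) (A : set R) :
  2 <= s -> (s - 1) * (s' - 1) = 1 -> bmeas phi -> 0 < X -> 0 < lam ->
  (forall k, (0 < k < n)%N -> a k ^+ 2 + b k ^+ 2 <= (64 / k%:R) ^+ 2) ->
  \sum_(1 <= k < n) (coef_norm phi k / k%:R) `^ s' <= X `^ s' ->
  measurable A ->
  (forall x, A x ->
    lam <= `|mean (fun y => (\sum_(1 <= k < n) harmonic k (a k) (b k) (x - y)) * phi y)|) ->
  mean (\1_A : R -> R) <= (128 * X / lam) `^ s.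
Proof.
move=> s2 ss' bphi X0 l0 hab hX mA hA.
have c0 k : 0 <= coef_norm phi k :> R by exact: sqrtr_ge0.
have -> : 128 * X / lam = 2 * (64 * X) / lam by lra.
apply: (weak_hausdorff_young R s s' n
  (fun k => a k * cos_coef phi k - b k * sin_coef phi k)
  (fun k => a k * sin_coef phi k + b k * cos_coef phi k)
  (fun k => 64 / k%:R * coef_norm phi k)) => //.
- by rewrite mulr_gt0.
- by move=> k; rewrite mulr_ge0.
- by move=> k kn; apply: conv_amplitude_le => //; exact: hab.
- rewrite powRM ?(ltW X0)// -(ler_pM2l (powR_gt0 s' (_ : 0 < 64))) // in hX *.
  rewrite (le_trans _ hX)// mulr_sumr; apply: ler_sum => k _.
  rewrite -powRM ?divr_ge0//.
  by have -> : 64 / k%:R * coef_norm phi k = 64 * (coef_norm phi k / k%:R) by ring.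
- move=> x Ax; apply: (le_trans (hA x Ax)).
  rewrite (_ : (fun y => _) = (fun y => \sum_(1 <= k < n) (harmonic k (a k) (b k) (x - y) * phi y))).
    rewrite mean_sum; last first.
      by move=> k; apply: bmeasM => //; exact: bmeas_harmonic_shift.
    by under eq_bigr do rewrite mean_harmonic_conv//.
  by apply/funext => y; rewrite mulr_suml.
Qed.

(** If lam < 64 X the right side exceeds 1. Otherwise the term 32 M / n takes at most
    half of lam, and one of the two trigonometric polynomials is at least lam / 4. *)
Lemma prim_level_set_le (R : realType) (s s' : R) (n : nat) (phi : R -> R)
    (M X lam : R) (A : set R) :
  2 <= s -> (s - 1) * (s' - 1) = 1 -> (0 < n)%N -> bmeas phi -> mean phi = 0 ->
  {ae torus_measure R, forall y, - M <= phi y} -> 0 < X -> M / n%:R <= X ->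
  \sum_(1 <= k < n) (coef_norm phi k / k%:R) `^ s' <= X `^ s' ->
  0 < lam -> measurable A -> (forall x, A x -> 0 <= x <= 1 /\ lam <= `|prim phi x|) ->
  mean (\1_A : R -> R) <= 2 * (512 * X / lam) `^ s.
Proof.
move=> s2 ss' n0 bphi phi0 aeM X0 MX hX l0 mA hA.
have [small|big] := ltP lam (64 * X).
  apply: (le_trans (mean_indic_le1 _ _ mA)).
  have h1 : 1 <= (512 * X / lam) `^ s.
    rewrite -[leLHS](powRr0 (512 * X / lam)) ler_powR//; last by lra.
    by rewrite ler_pdivlMr// mul1r; lra.
  by move: h1; move: (_ `^ _) => p; lra.
pose P1 x := mean (fun y => (\sum_(1 <= k < n) harmonic k 0 (riesz_coef n k) (x - y)) * phi y).
pose P2 x := mean (fun y =>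
  (\sum_(1 <= k < n) harmonic k (major_cos n k) (major_sin n k) (x - y)) * phi y).
have bconv (a b : nat -> R) : bmeas (fun x => mean (fun y =>
    (\sum_(1 <= k < n) harmonic k (a k) (b k) (x - y)) * phi y)).
  rewrite (_ : (fun x => _) = (fun x => \sum_(1 <= k < n)
    harmonic k (a k * cos_coef phi k - b k * sin_coef phi k)
             (a k * sin_coef phi k + b k * cos_coef phi k) x)).
    by apply: bmeas_sum => k; exact: bmeas_harmonic.
  apply/funext => x.
  rewrite (_ : (fun y => _) = (fun y => \sum_(1 <= k < n) (harmonic k (a k) (b k) (x - y) * phi y))).
    rewrite mean_sum; last first.
      by move=> k; apply: bmeasM => //; exact: bmeas_harmonic_shift.
    by under eq_bigr do rewrite mean_harmonic_conv//.
  by apply/funext => y; rewrite mulr_suml.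
have bP1 : bmeas P1 by exact: bconv.
have bP2 : bmeas P2 by exact: bconv.
pose A1 := A `&` [set x | lam / 4 <= `|P1 x|].
pose A2 := A `&` [set x | lam / 4 <= `|P2 x|].
have mA1 : measurable A1.
  by apply: measurableI => //; apply: measurable_superlevel; exact: bmeas_norm.
have mA2 : measurable A2.
  by apply: measurableI => //; apply: measurable_superlevel; exact: bmeas_norm.
have l4 : 0 < lam / 4 by rewrite divr_gt0.
have e : 512 * X / lam = 128 * X / (lam / 4) by field; rewrite gt_eqF.
have h1 : mean (\1_A1 : R -> R) <= (512 * X / lam) `^ s.
  rewrite e; apply: (conv_level_set_le R s s' n phi (fun=> 0) (riesz_coef n)) => //.
    exact: riesz_coef_sqr_le.
  by move=> x [].
have h2 : mean (\1_A2 : R -> R) <= (512 * X / lam) `^ s.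
  rewrite e; apply: (conv_level_set_le R s s' n phi (major_cos n) (major_sin n)) => //.
    exact: major_coef_sqr_le.
  by move=> x [].
have b1 := bmeas_indic _ _ mA1; have b2 := bmeas_indic _ _ mA2.
apply: (@le_trans _ _ (mean (\1_A1 : R -> R) + mean (\1_A2 : R -> R))); last first.
  move: h1 h2; set p := (_ `^ s); move: p => p; move: (mean _) (mean _) => u v.
  by clear; lra.
rewrite -meanD//; apply: le_mean => [||x].
- exact: bmeas_indic.
- exact: bmeasD.
have i0 (B : set R) : 0 <= (\1_B x : R) by rewrite indicE.
have i1 (B : set R) : B x -> \1_B x = 1 :> R by move=> Bx; rewrite indicE mem_set.
rewrite [leLHS]indicE; case: (boolP (x \in A)) => [|_]; last by rewrite addr_ge0.
rewrite inE => Ax; have [x01 lx] := hA x Ax.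
have := norm_prim_le _ _ _ _ x n0 bphi phi0 aeM x01.
have -> : mean (fun y => riesz_saw n (x - y) * phi y) = P1 x.
  by rewrite /P1; under eq_fun do rewrite riesz_saw_harmonic.
have -> : mean (fun y => (saw_major n (x - y) - 32 / n%:R) * phi y) = P2 x.
  rewrite /P2; congr mean; apply/funext => y.
  by rewrite saw_major_harmonic// addrAC subrr add0r.
move=> hp.
have [p1|p1] := lerP (lam / 4) `|P1 x|; first by rewrite (i1 A1)// lerDl.
have [p2|p2] := lerP (lam / 4) `|P2 x|; first by rewrite (i1 A2)// lerDr.
exfalso; move: hp p1 p2 lx MX big.
move: (`|P1 x|) (`|P2 x|) (`|prim phi x|) (M / n%:R) => u v w z; clear; lra.
Qed.

(** * Mass on intervals of constant sign *)

Lemma mean_point (R : realType) (f : R -> R) (b : R) : bmeas f -> 0 <= b <= 1 ->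
  mean (fun y => \1_(`[b, b]%classic) y * `|f y|) = 0.
Proof.
move=> [mf [B fB]] /andP[b0 b1]; have bf : bmeas f by split=> //; exists B.
have bi := bmeas_indic_itv R `[b, b].
apply/eqP; rewrite eq_le; apply/andP; split; last first.
  by apply: mean_ge0 => x; rewrite mulr_ge0// indicE.
apply: (@le_trans _ _ (mean (fun y => B * \1_(`[b, b]%classic) y))).
  apply: le_mean => [||x].
  - by apply: bmeasM => //; exact: bmeas_norm.
  - exact: bmeasZ.
  - by rewrite mulrC ler_wpM2r// indicE.
by rewrite meanZ// mean_itv// subrr mulr0.
Qed.

(** Only the values on [0, 1] matter; stated through increments so that no
    derivative is involved. *)
Definition antideriv {R : realType} (f F : R -> R) : Prop :=
  forall a b, 0 <= a -> a <= b -> b <= 1 ->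
    F b - F a = mean (fun y => \1_(`[a, b[%classic) y * f y).

Lemma antideriv_lipschitz (R : realType) (f F : R -> R) : bmeas f -> antideriv f F ->
  exists2 B, 0 <= B &
    forall x y, 0 <= x <= 1 -> 0 <= y <= 1 -> `|F x - F y| <= B * `|x - y|.
Proof.
move=> [mf [B fB]] aF; have bf : bmeas f by split=> //; exists B.
exists B; first exact: le_trans (normr_ge0 _) (fB 0).
move=> x y; wlog xy : x y / y <= x.
  move=> W x01 y01; have /orP[h|h] := le_total y x; first exact: W.
  by rewrite distrC (distrC x); exact: W.
move=> /andP[x0 x1] /andP[y0 y1]; rewrite aF//.
have bi := bmeas_indic_itv R `[y, x[.
apply: le_trans (norm_mean_le _ _ (bmeasM _ _ _ bi bf)) _.
rewrite (ger0_norm (_ : 0 <= x - y)) ?subr_ge0// -(mean_itv _ _ _ true true y0 xy x1) -meanZ//.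
apply: le_mean => [||z].
- by apply: bmeas_norm; exact: bmeasM.
- exact: bmeasZ.
- rewrite normrM mulrC; have -> : `|\1_(`[y, x[%classic) z : R| = \1_(`[y, x[%classic) z.
    by rewrite ger0_norm// indicE.
  by rewrite ler_wpM2r// indicE.
Qed.

(** Between the infimum a and the supremum b of the set, f keeps its sign, so the mass
    of |f| there is |F b - F a|; by continuity both endpoints still satisfy
    |F| <= lam. *)
Lemma one_sign_mass_le (R : realType) (f F : R -> R) (sg lam u v : R) :
  bmeas f -> antideriv f F -> 0 <= lam -> `|sg| = 1 ->
  measurable [set x : R | `|F x| <= lam] ->
  0 <= u -> u <= v -> v <= 1 -> (forall y, u <= y < v -> sg * f y <= 0) ->
  mean (fun y => \1_([set x | `|F x| <= lam] `&` `[u, v[%classic) y * `|f y|) <= 2 * lam.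
Proof.
move=> bf aF l0 sg1 mK u0 uv v1 fs.
set T := [set x | `|F x| <= lam] `&` `[u, v[%classic.
have Tuv x : T x -> u <= x < v by move=> [_] /=; rewrite in_itv.
have [T0|/set0P[t0 Tt0]] := eqVneq T set0.
  rewrite T0; under eq_fun do rewrite indic0 mul0r.
  by rewrite mean_cst mulr_ge0.
have hs : has_sup T.
  by split; [exists t0 | exists v => x /Tuv /andP[_ /ltW]].
have hi : has_inf T.
  by split; [exists t0 | exists u => x /Tuv /andP[]].
have [B B0 FB] := antideriv_lipschitz _ _ _ bf aF.
pose a := inf T; pose b := sup T.
have aT x : T x -> a <= x by move=> Tx; apply: ge_inf => //; case: hi.
have bT x : T x -> x <= b by move=> Tx; apply: ub_le_sup => //; case: hs.
have ua : u <= a by apply: lb_le_inf => [|x /Tuv /andP[]]; [exists t0|].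
have bv : b <= v by apply: ge_sup => [|x /Tuv /andP[_ /ltW]]; [exists t0|].
have ab : a <= b by rewrite (le_trans (aT _ Tt0)) ?bT.
have a01 : 0 <= a <= 1 by rewrite (le_trans u0 ua) (le_trans ab (le_trans bv v1)).
have b01 : 0 <= b <= 1 by rewrite (le_trans u0 (le_trans ua ab)) (le_trans bv v1).
have T01 x : T x -> 0 <= x <= 1.
  by move=> /Tuv /andP[ux /ltW xv]; rewrite (le_trans u0 ux) (le_trans xv v1).
have lim c : 0 <= c <= 1 -> (forall e, 0 < e -> exists2 x, T x & `|c - x| < e) ->
    `|F c| <= lam.
  move=> c01 hc; apply/ler_addgt0Pr => e e0.
  have d0 : 0 < e / (B + 1) by rewrite divr_gt0// ltr_wpDl.
  have [x Tx cx] := hc _ d0.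
  rewrite -(subrK (F x) (F c)) addrC (le_trans (ler_normD _ _))// lerD//.
    by case: Tx.
  rewrite (le_trans (FB _ _ c01 (T01 _ Tx)))// (@le_trans _ _ ((B + 1) * `|c - x|))//.
    by rewrite ler_wpM2r// lerDl.
  by rewrite mulrC -ler_pdivlMr ?ltr_wpDl// ltW.
have Fa : `|F a| <= lam.
  apply: lim => // e e0; have [x Tx xa] := inf_adherent e0 hi.
  exists x => //; rewrite distrC ger0_norm ?subr_ge0 ?aT//.
  by rewrite ltrBlDl.
have Fb : `|F b| <= lam.
  apply: lim => // e e0; have [x Tx xa] := sup_adherent e0 hs.
  exists x => //; rewrite ger0_norm ?subr_ge0 ?bT//.
  by rewrite ltrBlDr -ltrBlDl.
have bi := bmeas_indic_itv R `[a, b[; have bj := bmeas_indic_itv R `[b, b].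
have bn := bmeas_norm _ _ bf.
have mT : measurable T by apply: measurableI => //; exact: measurable_itv.
have bT' := bmeas_indic _ _ mT.
(* The closed point b is left out here and is recovered below as a null set. *)
have e1 : mean (fun y => \1_(`[a, b[%classic) y * `|f y|) = - sg * (F b - F a).
  case/andP: a01 => a0 _; case/andP: b01 => _ b1.
  rewrite aF// -meanZ; last exact: bmeasM.
  congr mean; apply/funext => y; rewrite indicE mem_setE in_itv/=.
  case: (boolP (a <= y < b)) => [/andP[ay yb]|_]; last by rewrite !mul0r mulr0.
  rewrite !mul1r -[LHS]mul1r -sg1 -normrM ler0_norm ?mulNr// fs//.
  by rewrite (le_trans ua ay) (lt_le_trans yb bv).
apply: (@le_trans _ _ (mean (fun y => \1_(`[a, b[%classic) y * `|f y|) +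
   mean (fun y => \1_(`[b, b]%classic) y * `|f y|))).
  rewrite -meanD; [|exact: bmeasM..].
  apply: le_mean => [||y]; [exact: bmeasM|by apply: bmeasD; exact: bmeasM|].
  rewrite -mulrDl ler_wpM2r// [leLHS]indicE.
  case: (boolP (y \in T)) => [|_]; last by rewrite addr_ge0// indicE.
  rewrite inE => Ty; have ay := aT _ Ty; have yb := bT _ Ty.
  rewrite !indicE !mem_setE !in_itv/= ay yb andbT/=.
  have [//|yb'] := ltP y b; rewrite ?yb'/= ?addr0 ?add0r//.
rewrite mean_point// addr0 e1 (le_trans (ler_norm _))// normrM normrN sg1 mul1r.
by rewrite (le_trans (ler_normB _ _))// mulr_natl mulr2n lerD.
Qed.

(** * Sign changes *)

(** Points of [u, 1) in increasing order at which f takes alternating signs, the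
    first being the sign of sg. Strict monotonicity follows from the alternation. *)
Fixpoint sign_chain {R : realType} (f : R -> R) (sg u : R) (xs : seq R) : bool :=
  if xs is x :: t then [&& u <= x, x < 1, 0 < sg * f x & sign_chain f (- sg) x t]
  else true.

(** Induction on the maximal length of a chain. Let w be the infimum of the points
    where f has the sign of sg. Before w the function has one sign. After w, a chain
    starting with the opposite sign can be extended to the left by a point of sign
    sg, so these chains are shorter. *)
Lemma chain_mass_le (R : realType) (f F : R -> R) (lam : R) :
  bmeas f -> continuous f -> antideriv f F -> 0 <= lam ->
  measurable [set x : R | `|F x| <= lam] ->
  forall (L : nat) (sg u : R), `|sg| = 1 -> 0 <= u <= 1 ->
  (forall xs, sign_chain f sg u xs -> (size xs <= L)%N) ->
  mean (fun y => \1_([set x | `|F x| <= lam] `&` `[u, 1[%classic) y * `|f y|)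
    <= 2 * lam * L.+1%:R.
Proof.
move=> bf cf aF l0 mK; set K := [set x | _]; elim=> [|L IH] sg u sg1 /andP[u0 u1] hL.
  rewrite mulr1; apply: (one_sign_mass_le _ f F sg lam u 1) => // y /andP[uy y1].
  by rewrite leNgt; apply/negP => fy; have := hL [:: y]; rewrite /= uy y1 fy => /(_ isT).
pose S := [set y : R | u <= y < 1 /\ 0 < sg * f y].
have l2 : 0 <= 2 * lam by rewrite mulr_ge0.
have [S0|/set0P[z0 Sz0]] := eqVneq S set0.
  apply: (@le_trans _ _ (2 * lam)); last by rewrite ler_peMr// ler1n.
  apply: (one_sign_mass_le _ f F sg lam u 1) => // y uy.
  rewrite leNgt; apply/negP => fy.
  by suff : S y by rewrite S0.
have hi : has_inf S by split; [exists z0 | exists u => y [/andP[]]].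
pose w := inf S.
have uw : u <= w by apply: lb_le_inf => [|y [/andP[]]]; [exists z0|].
have wS y : S y -> w <= y by move=> Sy; apply: ge_inf => //; case: hi.
have w1 : w < 1 by case: (Sz0) => /andP[_ z1] _; exact: le_lt_trans (wS _ Sz0) z1.
have split_mass : mean (fun y => \1_(K `&` `[u, 1[%classic) y * `|f y|) <=
   mean (fun y => \1_(K `&` `[u, w[%classic) y * `|f y|) +
   mean (fun y => \1_(K `&` `[w, 1[%classic) y * `|f y|).
  have bi (i : interval R) : bmeas (fun y => \1_(K `&` [set` i]) y * `|f y|).
    apply: bmeasM; last exact: bmeas_norm.
    by apply: bmeas_indic; apply: measurableI => //; exact: measurable_itv.
  rewrite -meanD//; apply: le_mean => [||y]; [exact: bi|by apply: bmeasD; exact: bi|].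
  rewrite -mulrDl ler_wpM2r// !indicE !in_setI.
  case: (y \in K); last by rewrite /= addr0.
  rewrite !mem_setE !in_itv/=; case: (ltP y w) => yw; rewrite ?andbT ?andbF/=.
    by case: (u <= y); case: (y < 1); rewrite /= ?addr0 ?ler01.
  by case: (u <= y); case: (y < 1); rewrite /= ?add0r ?ler01.
apply: (le_trans split_mass).
have -> : 2 * lam * L.+2%:R = 2 * lam + 2 * lam * L.+1%:R.
  by rewrite -[L.+2%:R]natr1 mulrDr mulr1 addrC.
apply: lerD.
  apply: (one_sign_mass_le _ f F sg lam u w) => //; first exact: ltW.
  move=> y /andP[uy yw]; rewrite leNgt; apply/negP => fy.
  have : S y by split=> //; rewrite uy (lt_trans yw w1).
  by move/wS; rewrite leNgt yw.
apply: (IH (- sg)); first by rewrite normrN.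
  by rewrite (le_trans u0 uw) ltW.
move=> [//|x t] /=; rewrite opprK => /and4P[wx x1 fx xt].
have fx' : sg * f x < 0 by rewrite -oppr_gt0 -mulNr.
(* w is the infimum of S and f has the sign of - sg at x, so S has points
   below x, even when x = w. *)
have [z Sz zx] : exists2 z, S z & z <= x.
  have [wx'|] := ltP w x.
    have xw0 : 0 < x - w by rewrite subr_gt0.
    have [z Sz zx] := inf_adherent xw0 hi; exists z => //.
    by rewrite ltW//; move: zx; rewrite addrC subrK.
  move=> xw; have ex : x = w by apply/eqP; rewrite eq_le xw wx.
  have cg : (fun y => sg * f y) y @[y --> x] --> sg * f x.
    by apply: cvgM; [exact: cvg_cst | exact: cf].
  have /nbhs_ballP[d /= d0 hd] : nbhs x [set y : R | sg * f y < 0].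
    exact: (@cvgr_lt _ _ _ _ _ _ cg 0 fx').
  have [z Sz zx] := inf_adherent d0 hi.
  exfalso; have : sg * f z < 0.
    apply: hd; rewrite /ball/= ex ltr_norml; have := wS _ Sz; rewrite -/w in zx *.
    by move=> wz; apply/andP; split; lra.
  by case: Sz => _ fz /lt_trans /(_ fz); rewrite ltxx.
have := hL (z :: x :: t); case: Sz => /andP[uz z1] fz.
by rewrite /= uz z1 fz zx x1 fx opprK xt => /(_ isT).
Qed.

Lemma opposite_signs (R : realType) (sg a b : R) : `|sg| = 1 ->
  0 < sg * a -> 0 < - sg * b -> a * b < 0.
Proof.
move=> sg1 ha hb; have s2 : sg * sg = 1.
  by rewrite -expr2 -real_normK ?num_real// sg1 expr1n.
have := mulr_gt0 ha hb.
have -> : sg * a * (- sg * b) = - (sg * sg * (a * b)) by ring.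
by rewrite s2 mul1r oppr_gt0.
Qed.

Lemma sign_chain_path (R : realType) (f : R -> R) (t : seq R) (sg u x : R) :
  `|sg| = 1 -> sign_chain f sg u (x :: t) ->
  [/\ all (fun y => u <= y < 1) (x :: t), path <%R x t,
      path (fun a b => f a * f b < 0) x t, 0 < sg * f x &
      0 < (if odd (size t) then - sg else sg) * f (last x t)].
Proof.
elim: t sg u x => [|y t IH] sg u x sg1 /=.
  by move=> /and4P[-> -> -> _].
move=> /and5P[ux x1 fx xy /and3P[y1 fy ct]].
have sg1' : `|- sg| = 1 by rewrite normrN.
have [|al pl pf _ fl] := IH (- sg) x y sg1'; first by rewrite /= xy y1 fy.
have fxy := opposite_signs _ _ _ _ sg1 fx fy.
split=> //.
- rewrite /= ux x1/= (le_trans ux xy) y1/=.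
  move: al => /= /andP[_]; apply: sub_all => z /andP[xz ->].
  by rewrite (le_trans ux xz).
- rewrite /= pl andbT lt_neqAle xy andbT; apply: contraTneq fxy => ->.
  by rewrite -leNgt -expr2 sqr_ge0.
- by rewrite /= fxy pf.
- by move: fl; case: (odd _); rewrite /= ?opprK.
Qed.

Lemma sign_chain_prefix (R : realType) (f : R -> R) (s t : seq R) (sg u : R) :
  sign_chain f sg u (s ++ t) -> sign_chain f sg u s.
Proof.
by elim: s sg u => [//|x s IH] sg u /= /and4P[-> -> -> /IH ->].
Qed.

Lemma alternating_size_le (R : realType) (f : R -> R) (xs : seq R) :
  (sign_changes f < +oo)%E -> alternating_points f xs ->
  (size xs)%:R <= fine (sign_changes f).
Proof.
move=> fin alt.
have ub : ((size xs)%:R%:E <= sign_changes f)%E.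
  by apply: ereal_sup_ubound; exists xs.
have fn : sign_changes f \is a fin_num.
  by rewrite ge0_fin_numE// (le_trans _ ub)// lee_fin.
by rewrite -lee_fin fineK.
Qed.

Lemma sign_chain_alternating (R : realType) (f : R -> R) (t : seq R) (sg x : R) :
  `|sg| = 1 -> odd (size t) -> sign_chain f sg 0 (x :: t) -> alternating_points f (x :: t).
Proof.
move=> sg1 ot /(sign_chain_path _ _ _ _ _ _ sg1)[al pl pf fx fl].
rewrite /alternating_points al /= pl rcons_path pf /= mulrC.
by rewrite ot in fl; exact: opposite_signs fx fl.
Qed.

(** A chain of even length is cyclically alternating; a chain of odd length becomes
    so after its last point is dropped. *)
Lemma sign_chain_size_le (R : realType) (f : R -> R) (xs : seq R) (sg : R) :
  `|sg| = 1 -> (sign_changes f < +oo)%E -> sign_chain f sg 0 xs ->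
  (size xs)%:R <= fine (sign_changes f) + 1.
Proof.
move=> sg1 fin; have N0 : 0 <= fine (sign_changes f).
  exact: (alternating_size_le _ f [::] fin).
case: xs => [|x t] ct; first by rewrite addr_ge0.
have [ot|et] := boolP (odd (size t)).
  rewrite (le_trans (alternating_size_le _ _ _ fin (sign_chain_alternating _ _ _ _ _ sg1 ot ct)))//.
  by rewrite lerDl.
case/lastP: t et ct => [|t y]; first by move=> _ _; rewrite lerDr.
rewrite /= size_rcons /= negbK => ot ct.
rewrite -natr1 lerD2r.
have ct' : sign_chain f sg 0 (x :: t).
  by apply: (sign_chain_prefix _ _ _ [:: y]); rewrite /= cats1.
exact: (alternating_size_le _ _ _ fin (sign_chain_alternating _ _ _ _ _ sg1 ot ct')).
Qed.

(** If phi had one sign, mean zero would force |phi| to have mean zero; two points of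
    opposite signs already form an alternating pair. *)
Lemma sign_changes_ge2 (R : realType) (phi : R -> R) :
  torus_continuous phi -> mean phi = 0 -> 0 < mean (fun x => `|phi x|) ->
  (sign_changes phi < +oo)%E -> 2 <= fine (sign_changes phi).
Proof.
move=> tc phi0 m0 fin; have bphi := bmeas_torus _ _ tc; case: tc => cphi pphi.
have ex sg : `|sg| = 1 -> exists z, 0 <= z < 1 /\ 0 < sg * phi z.
  move=> sg1; apply: contrapT => H.
  have le0 x : sg * phi x <= 0.
    have [z [z01 ->]] := periodic_fracE _ _ x pphi.
    by rewrite leNgt; apply/negP => h; apply: H; exists z.
  move: m0; have -> : (fun x => `|phi x|) = (fun x => - sg * phi x).
    apply/funext => x; rewrite mulNr -ler0_norm ?le0// normrM sg1 mul1r//.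
  by rewrite meanZ// phi0 mulr0 ltxx.
have [z1 [z101 f1]] := ex 1 (normr1 _).
have [z2 [z201 f2]] := ex (-1) (normrN1 _).
have f12 := opposite_signs _ _ _ _ (normr1 _) f1 f2.
have [h|h|h] := ltgtP z1 z2.
- apply: (alternating_size_le _ phi [:: z1; z2] fin).
  by rewrite /alternating_points/= z101 z201 h f12 mulrC f12.
- apply: (alternating_size_le _ phi [:: z2; z1] fin).
  by rewrite /alternating_points/= z101 z201 h f12 mulrC f12.
- by move: f12; rewrite h ltNge -expr2 sqr_ge0.
Qed.

(** Freezing a function outside [0, 1] turns its Lipschitz bound there into one on
    the line, hence into measurability. *)
Definition clip {R : realType} (x : R) : R :=
  if x < 0 then 0 else if 1 < x then 1 else x.

Lemma clip_id (R : realType) (x : R) : 0 <= x <= 1 -> clip x = x.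
Proof. by move=> /andP[x0 x1]; rewrite /clip ltNge x0 ltNge x1. Qed.

Lemma clip_itv (R : realType) (x : R) : 0 <= clip x <= 1.
Proof.
rewrite /clip; case: ltP => [_|x0]; first by rewrite lexx ler01.
by case: ltP => [_|x1]; rewrite ?lexx ?ler01// x0 x1.
Qed.

Lemma clip_lipschitz (R : realType) (x y : R) : `|clip x - clip y| <= `|x - y|.
Proof.
have h1 := ler_norm (x - y); have h2 := ler_norm (- (x - y)); rewrite normrN in h2.
rewrite ler_norml /clip.
case: (ltP x 0) => x0; case: (ltP y 0) => y0; case: (ltP 1 x) => x1; case: (ltP 1 y) => y1;
by apply/andP; split; lra.
Qed.

Lemma bmeas_antideriv_clip (R : realType) (f F : R -> R) :
  bmeas f -> antideriv f F -> bmeas (fun x => F (clip x)).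
Proof.
move=> bf aF; have [B B0 FB] := antideriv_lipschitz _ _ _ bf aF.
have lip x y : `|F (clip x) - F (clip y)| <= B * `|x - y|.
  by rewrite (le_trans (FB _ _ (clip_itv _ _) (clip_itv _ _)))// ler_wpM2l// clip_lipschitz.
split.
  apply: continuous_measurable_fun => x; apply/cvgrPdist_lt => e e0.
  have d0 : 0 < e / (B + 1) by rewrite divr_gt0// ltr_wpDl.
  apply/nbhs_ballP; exists (e / (B + 1)) => //= y.
  rewrite /ball/= => xy; rewrite (le_lt_trans (lip _ _))//.
  rewrite (@le_lt_trans _ _ ((B + 1) * `|x - y|))//; first by rewrite ler_wpM2r// lerDl.
  by rewrite mulrC -ltr_pdivlMr// ltr_wpDl.
exists (B + `|F (clip 0)|) => x.
rewrite -(subrK (F (clip 0)) (F (clip x))) (le_trans (ler_normD _ _))// lerD2r.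
rewrite (le_trans (FB _ _ (clip_itv _ _) (clip_itv _ _)))// ler_piMr//.
rewrite [clip 0]clip_id ?lexx ?ler01// subr0.
by have /andP[c0 c1] := clip_itv _ x; rewrite ger0_norm.
Qed.

(** * Level sets of the primitive: lower bound *)

Lemma antideriv_prim (R : realType) (phi : R -> R) : bmeas phi -> mean phi = 0 ->
  antideriv phi (fun x => prim phi (clip x)).
Proof.
move=> bphi phi0 a b a0 ab b1.
rewrite !clip_id ?a0 ?(le_trans ab b1) ?(le_trans a0 ab)//.
exact: primB.
Qed.

(** At most N + 2 <= 2 N intervals of constant sign cover [0, 1), each
    carrying at most 2 lam of the mass of |phi| where |prim phi| <= lam; with
    lam = m / (8 N) this is at most m / 2. *)
Lemma large_prim_mass (R : realType) (phi : R -> R) (m N : R) :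
  torus_continuous phi -> mean phi = 0 -> m = mean (fun x => `|phi x|) -> 0 < m ->
  (sign_changes phi < +oo)%E -> N = fine (sign_changes phi) ->
  exists A : set R, [/\ measurable A,
    (forall x, A x -> 0 <= x <= 1 /\ m / (8 * N) <= `|prim phi x|) &
    m / 2 <= mean (fun y => \1_A y * `|phi y|)].
Proof.
move=> tc phi0 mE m0 fin NE.
have bphi := bmeas_torus _ _ tc.
have N2 : 2 <= N by rewrite NE; apply: sign_changes_ge2 => //; rewrite -mE.
have N0 : 0 < N by rewrite (lt_le_trans _ N2).
set lam := m / (8 * N); have l0 : 0 < lam by rewrite divr_gt0// mulr_gt0.
pose F x := prim phi (clip x).
have aF : antideriv phi F by exact: antideriv_prim.
have bF : bmeas F.
  rewrite /F; have := bmeas_antideriv_clip _ _ _ bphi aF; rewrite /F.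
  suff -> : (fun x => prim phi (clip (clip x))) = (fun x => prim phi (clip x)) by [].
  by apply/funext => x; rewrite clip_id// clip_itv.
pose K := [set x : R | `|F x| <= lam].
have mK : measurable K.
  have -> : K = [set x : R | - lam <= -1 * `|F x|].
    by apply/seteqP; split => x; rewrite /K/= mulN1r lerN2.
  by apply: measurable_superlevel; apply: bmeasZ; exact: bmeas_norm.
pose A := `[0, 1[%classic `\` K.
have mA : measurable A by apply: measurableD => //; exact: measurable_itv.
exists A; split => //.
  move=> x [] /=; rewrite in_itv/= => /andP[x0 x1] /negP; rewrite -ltNge => /ltW h.
  by rewrite x0 (ltW x1); split=> //; move: h; rewrite /F clip_id// x0 ltW.
pose L := Num.truncn (N + 1).
have L1 : L%:R <= N + 1 by rewrite truncn_le// addr_ge0// ltW.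
have hK : mean (fun y => \1_(K `&` `[0, 1[%classic) y * `|phi y|) <= 2 * lam * L.+1%:R.
  apply: (chain_mass_le _ phi F lam bphi tc.1 aF (ltW l0) mK L 1 0 (normr1 _)).
    by rewrite lexx ler01.
  move=> xs /(sign_chain_size_le _ _ _ _ (normr1 _) fin); rewrite -NE => h.
  by rewrite truncn_ge_nat// addr_ge0// ltW.
have hK2 : 2 * lam * L.+1%:R <= m / 2.
  apply: (@le_trans _ _ (2 * lam * (N + 2))).
    rewrite ler_pM2l; last exact: mulr_gt0.
    by rewrite -(@natr1 R L); move: (L%:R) L1 => l; clear; lra.
  have -> : m / 2 = 4 * lam * N by rewrite /lam; field; rewrite gt_eqF.
  rewrite mulrAC [leRHS]mulrAC ler_pM2r//; move: N2; clear; lra.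
have b1 : bmeas (fun y => \1_(K `&` `[0, 1[%classic) y * `|phi y|).
  apply: bmeasM; last exact: bmeas_norm.
  by apply: bmeas_indic; apply: measurableI => //; exact: measurable_itv.
have b2 : bmeas (fun y => \1_A y * `|phi y|).
  by apply: bmeasM; [exact: bmeas_indic | exact: bmeas_norm].
have b3 : bmeas (fun y => \1_(`[1, 1]%classic) y * `|phi y|).
  by apply: bmeasM; [exact: bmeas_indic_itv | exact: bmeas_norm].
have : m <= mean (fun y => \1_(K `&` `[0, 1[%classic) y * `|phi y|) +
   mean (fun y => \1_A y * `|phi y|).
  have m1 : mean (fun y => \1_(`[1, 1]%classic) y * `|phi y|) = 0.
    by apply: mean_point => //; rewrite ler01 lexx.
  rewrite -[leRHS]addr0 -[X in _ <= _ + X]m1 mE.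
  rewrite -(meanD _ _ _ b1 b2) -meanD//; last exact: bmeasD.
  apply: le_mean_unit => [||x /andP[x0 x1]].
  - exact: bmeas_norm.
  - by apply: bmeasD => //; exact: bmeasD.
  rewrite -!mulrDl ler_peMl//.
  have [x1'|x1'] := ltP x 1.
    have x01 : x \in `[0, 1[%classic by rewrite inE/= in_itv/= x0.
    rewrite [X in _ <= _ + X]indicE mem_setE in_itv/= (leNgt 1 x) x1'/= addr0.
    rewrite !indicE in_setI in_setD x01 andbT/=.
    by case: (x \in K); rewrite /= ?addr0 ?add0r.
  have -> : x = 1 by apply/eqP; rewrite eq_le x1 x1'.
  rewrite [X in _ <= _ + X]indicE mem_setE in_itv/= lexx/= lerDr addr_ge0// indicE//.
move: (le_trans hK hK2).
move: (mean _) (mean _) => u v; clear; lra.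
Qed.

(** * Norms *)

Lemma bmeas_powR (R : realType) (f : R -> R) (p : R) : 0 <= p -> bmeas f ->
  bmeas (fun x => `|f x| `^ p).
Proof.
move=> p0 [mf [B fB]]; split.
  apply: (@measurableT_comp _ _ _ _ _ _ (@powR R ^~ p)); first exact: measurable_powR.
  exact: measurableT_comp.
exists (B `^ p) => x; rewrite ger0_norm ?powR_ge0//.
by apply: ge0_ler_powR => //; rewrite nnegrE// (le_trans _ (fB x)).
Qed.

Lemma EFin_mean (R : realType) (f : R -> R) : bmeas f ->
  (mean f)%:E = (\int[torus_measure R]_x (f x)%:E)%E.
Proof.
move=> bf; rewrite /mean /Rintegral fineK//.
by apply: integrable_fin_num => //; exact: bmeas_integrable.
Qed.

Lemma LnormE (R : realType) (f : R -> R) (p : R) : 0 < p -> bmeas f ->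
  ('N[torus_measure R]_p%:E[EFin \o f] = ((mean (fun x => `|f x| `^ p)) `^ p^-1)%:E)%E.
Proof.
move=> p0 bf; rewrite unlock.
under eq_integral => x _ do rewrite /= .
rewrite -EFin_mean//; exact: bmeas_powR (ltW p0) bf.
Qed.

Lemma Lp_normE (R : realType) (f : R -> R) (p : R) : 0 < p -> bmeas f ->
  Lp_norm p%:E f = (mean (fun x => `|f x| `^ p)) `^ p^-1.
Proof. by move=> p0 bf; rewrite /Lp_norm LnormE. Qed.

Lemma L1_normE (R : realType) (f : R -> R) : bmeas f ->
  Lp_norm 1%E f = mean (fun x => `|f x|).
Proof.
move=> bf; rewrite Lp_normE// invr1 powRr1; last first.
  by apply: mean_ge0 => x; exact: powR_ge0.
by congr mean; apply/funext => x; rewrite powRr1.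
Qed.

Lemma Lp_norm_ge0 (R : realType) (f : R -> R) (p : \bar R) : 0 <= Lp_norm p f.
Proof. by rewrite /Lp_norm fine_ge0// Lnorm_ge0. Qed.

Lemma mean_hoelder (R : realType) (f g : R -> R) (p q : R) :
  0 < p -> 0 < q -> p^-1 + q^-1 = 1 -> bmeas f -> bmeas g ->
  mean (fun x => `|f x| * `|g x|) <=
  (mean (fun x => `|f x| `^ p)) `^ p^-1 * (mean (fun x => `|g x| `^ q)) `^ q^-1.
Proof.
move=> p0 q0 pq bf bg; have [mf _] := bf; have [mg _] := bg.
have := @hoelder _ _ _ (torus_measure R) f g p q mf mg p0 q0 pq.
rewrite Lnorm1 (LnormE _ _ _ p0 bf) (LnormE _ _ _ q0 bg) -EFinM.
have -> : (\int[torus_measure R]_x `|(EFin \o (f \* g)%R) x|)%E =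
   (mean (fun x => `|f x| * `|g x|))%:E.
  rewrite EFin_mean; last by apply: bmeasM; exact: bmeas_norm.
  by apply: eq_integral => x _; rewrite /= normrM.
by rewrite lee_fin.
Qed.

Lemma ae_le_Linfty (R : realType) (f : R -> R) : bmeas f ->
  {ae torus_measure R, forall x, `|f x| <= Lp_norm +oo%E f}.
Proof.
move=> [mf [B fB]]; rewrite /Lp_norm unlock.
have P0 : (0 < torus_measure R [set: measurableTypeR R])%E.
  by rewrite [X in (_ < X)%E](@probability_setT _ _ _ (torus_measure R)) lte01.
rewrite P0.
set e := ess_sup _ _.
have eB : (e <= B%:E)%E.
  by apply/ess_supP; apply: aeW => x /=; rewrite lee_fin.
have e0 : (0 <= e)%E by apply: ess_sup_gee => //; apply: aeW => x /=.
have ef : e \is a fin_num.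
  by rewrite ge0_fin_numE// (le_lt_trans eB)// ltry.
have h := @ess_sup_ge _ _ _ (torus_measure R) (abse \o (EFin \o f)).
apply: (@filterS _ _ (ae_filter_ringOfSetsType _) _ _ _ h) => x /=.
by rewrite -lee_fin fineK.
Qed.

Lemma ae_le_mean (R : realType) (f g : R -> R) : bmeas f -> bmeas g ->
  (forall x, 0 <= f x) -> (forall x, 0 <= g x) ->
  {ae torus_measure R, forall x, f x <= g x} -> mean f <= mean g.
Proof.
move=> bf bg f0 g0 fg; rewrite -lee_fin !EFin_mean//.
apply: ae_ge0_le_integral => //.
- by move=> x _; rewrite lee_fin.
- by apply/measurable_EFinP; case: bf.
- by move=> x _; rewrite lee_fin.
- by apply/measurable_EFinP; case: bg.
- by apply: (@filterS _ _ (ae_filter_ringOfSetsType _) _ _ _ fg) => x /= h _; rewrite lee_fin.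
Qed.

Lemma conjugate_real (R : realType) (r : R) : 1 < r ->
  fine (hoelder_conjugate r%:E) = r / (r - 1).
Proof.
move=> r1; rewrite /hoelder_conjugate/= eqe gt_eqF ?(lt_trans ltr01)//.
by rewrite -EFinD inver subr_eq0 gt_eqF.
Qed.

(** Hoelder with the indicator of A; for r = +oo the essential bound is used
    directly. *)
Lemma mass_on_set_le (R : realType) (f : R -> R) (r : \bar R) (A : set R) :
  (1 < r)%E -> bmeas f -> measurable A ->
  mean (fun x => \1_A x * `|f x|) <=
  Lp_norm r f * (mean (\1_A : R -> R)) `^ (fine (hoelder_conjugate r))^-1.
Proof.
move=> r1 bf mA; have bA := bmeas_indic _ _ mA; have bn := bmeas_norm _ _ bf.
case: r r1 => [r| |//].
  rewrite lte_fin => r1; rewrite conjugate_real//.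
  have r0 : 0 < r by rewrite (lt_trans ltr01).
  have rm : 0 < r - 1 by rewrite subr_gt0.
  have := mean_hoelder R f (\1_A) r (r / (r - 1)) r0 (divr_gt0 r0 rm) _ bf bA.
  have -> : (mean (fun x => `|f x| `^ r)) `^ r^-1 = Lp_norm r%:E f by rewrite Lp_normE.
  move=> h.
  have nA x : `|\1_A x : R| = \1_A x by rewrite ger0_norm// indicE.
  apply: le_trans (le_trans _ (h _)) _.
  - by apply: le_mean => [||x]; [exact: bmeasM| by apply: bmeasM => //; exact: bmeas_norm|
      rewrite mulrC nA].
  - by field; rewrite !gt_eqF.
  apply: ler_wpM2l; first exact: Lp_norm_ge0.
  have -> : (fun x => `|\1_A x : R| `^ (r / (r - 1))) = \1_A; last by [].
  apply/funext => x; rewrite nA indicE; case: (_ \in _); first by rewrite powR1.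
  by rewrite powR0// gt_eqF// divr_gt0.
move=> _; rewrite hoelder_conjugatey/= invr1 powRr1; last first.
  by apply: mean_ge0 => x; rewrite indicE.
rewrite -meanZ//; apply: ae_le_mean => [||x|x|].
- exact: bmeasM.
- exact: bmeasZ.
- by rewrite mulr_ge0// indicE.
- by rewrite mulr_ge0 ?Lp_norm_ge0// indicE.
- apply: (@filterS _ _ (ae_filter_ringOfSetsType _) _ _ _ (ae_le_Linfty _ _ bf)) => x /= h.
  by rewrite mulrC ler_wpM2r// indicE.
Qed.

(** The usual interpolation between L^1 and L^r. For finite r it is Hoelder applied to
    |f| ^ p = |f| ^ w * |f| ^ (r v) with exponents 1 / w and 1 / v, where w + v = 1
    and w + r v = p. *)
Lemma Lp_interpolation (R : realType) (f : R -> R) (p : R) (r : \bar R) :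
  bmeas f -> 1 <= p -> (1 < r)%E -> (p%:E < r)%E ->
  0 < mean (fun x => `|f x|) -> 0 < Lp_norm r f ->
  Lp_norm p%:E f <= Lp_norm r f *
    (mean (fun x => `|f x|) / Lp_norm r f) `^
      ((p^-1 - fine r^-1) * fine (hoelder_conjugate r)).
Proof.
move=> bf p1 r1 pr; set m := mean _ => m0 R0.
have p0 : 0 < p by rewrite (lt_le_trans ltr01).
have bn := bmeas_norm _ _ bf.
have split_pow (t : R) : Lp_norm r f * (m / Lp_norm r f) `^ t = m `^ t * Lp_norm r f `^ (1 - t).
  rewrite powRM ?(ltW m0) ?invr_ge0 ?(ltW R0)// powRB; last by rewrite (gt_eqF R0) implybT.
  rewrite -powR_inv1 ?(ltW R0)// -powRrM mulN1r powRN powRr1 ?(ltW R0)//.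
  by rewrite mulrCA.
rewrite split_pow (Lp_normE _ _ _ p0 bf).
have gen (th U : R) : 0 <= U -> mean (fun x => `|f x| `^ p) <= U -> 
    U `^ p^-1 = m `^ th * Lp_norm r f `^ (1 - th) ->
    (mean (fun x => `|f x| `^ p)) `^ p^-1 <= m `^ th * Lp_norm r f `^ (1 - th).
  move=> U0 h <-; apply: ge0_ler_powR => //; first by rewrite invr_ge0 ltW.
  by rewrite nnegrE; apply: mean_ge0 => x; exact: powR_ge0.
case: r r1 pr R0 split_pow gen => [r| |//]; last first.
  move=> _ _ R0 _ gen; rewrite hoelder_conjugatey/= ?invey/= subr0 mulr1.
  apply: (gen _ (m * Lp_norm +oo%E f `^ (p - 1))).
  - by rewrite mulr_ge0 ?powR_ge0// ltW.
  - rewrite mulrC -meanZ//.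
    apply: ae_le_mean => [||x|x|].
    + by apply: bmeas_powR => //; exact: ltW.
    + exact: bmeasZ.
    + exact: powR_ge0.
    + by rewrite mulr_ge0 ?powR_ge0.
    + apply: (@filterS _ _ (ae_filter_ringOfSetsType _) _ _ _ (ae_le_Linfty _ _ bf)) => x /= h.
      rewrite -(mulr_powRB1 (normr_ge0 (f x)) p0) mulrC ler_wpM2r//.
      by apply: ge0_ler_powR => //; rewrite ?subr_ge0 ?nnegrE// ltW.
  - rewrite powRM ?powR_ge0 ?(ltW m0)//; congr (_ * _).
    by rewrite -powRrM; congr (_ `^ _); field; rewrite gt_eqF.
rewrite !lte_fin => r1 pr R0 _ gen; rewrite conjugate_real// inver gt_eqF ?(lt_trans ltr01 r1)//=.
have r0 : 0 < r by rewrite (lt_trans ltr01).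
have rm : 0 < r - 1 by rewrite subr_gt0.
have rp : 0 < r - p by rewrite subr_gt0.
set th := ((p^-1 - r^-1) * (r / (r - 1))).
move: p1; rewrite le_eqVlt => /predU1P[p1|p1].
  have -> : th = 1.
    by rewrite /th -p1 invr1; field; rewrite (gt_eqF r0) (gt_eqF rm).
  rewrite subrr powRr0 mulr1 powRr1 ?(ltW m0)// -p1 invr1 powRr1; last first.
    by apply: mean_ge0 => x; exact: powR_ge0.
  by rewrite le_eqVlt; apply/orP; left; apply/eqP; congr mean; apply/funext => x; rewrite powRr1.
have pm : 0 < p - 1 by rewrite subr_gt0.
pose w := (r - p) / (r - 1); pose v := (p - 1) / (r - 1).
have w0 : 0 < w by rewrite divr_gt0.
have v0 : 0 < v by rewrite divr_gt0.
have wv : w + v = 1 by rewrite /w /v; field; rewrite gt_eqF.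
have wrv : w + r * v = p by rewrite /w /v; field; rewrite gt_eqF.
have bw := bmeas_powR _ _ _ (ltW w0) bf.
have bv := bmeas_powR _ _ _ (mulr_ge0 (ltW r0) (ltW v0)) bf.
have := mean_hoelder R _ _ w^-1 v^-1 _ _ _ bw bv.
rewrite !invr_gt0 !invrK => /(_ w0 v0 wv).
have -> : (fun x => `|(`|f x| `^ w)| * `|(`|f x| `^ (r * v))|) = (fun x => `|f x| `^ p).
  apply/funext => x; rewrite !(ger0_norm (powR_ge0 _ _)) -powRD ?wrv//.
  by rewrite (gt_eqF p0).
have -> : (fun x => `|(`|f x| `^ w)| `^ w^-1) = (fun x => `|f x|).
  apply/funext => x; rewrite (ger0_norm (powR_ge0 _ _)) -powRrM mulfV ?gt_eqF// powRr1//.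
have -> : (fun x => `|(`|f x| `^ (r * v))| `^ v^-1) = (fun x => `|f x| `^ r).
  by apply/funext => x; rewrite (ger0_norm (powR_ge0 _ _)) -powRrM mulfK ?gt_eqF.
rewrite -/m; set U := mean (fun x => `|f x| `^ r) => h.
have U0 : 0 <= U by apply: mean_ge0 => x; exact: powR_ge0.
apply: (gen _ (m `^ w * U `^ v)) => //; first by rewrite mulr_ge0 ?powR_ge0.
have -> : Lp_norm r%:E f = U `^ r^-1 by exact: Lp_normE.
rewrite (powRM _ (powR_ge0 m w) (powR_ge0 U v)) -(powRrM m w) -(powRrM U v) -(powRrM U r^-1).
congr (_ `^ _ * _ `^ _).
  by rewrite /th /w; field; rewrite !gt_eqF.
by rewrite /th /v; field; rewrite !gt_eqF.
Qed.

Lemma conjugateM (R : realType) (r : \bar R) : (1 < r)%E ->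
  fine (hoelder_conjugate r) * (1 - fine r^-1) = 1.
Proof.
case: r => [r| |//]; last by rewrite hoelder_conjugatey ?invey/= subr0 mulr1.
rewrite lte_fin => r1; rewrite conjugate_real// inver gt_eqF ?(lt_trans ltr01 r1)//=.
by field; rewrite subr_eq0 !gt_eqF// (lt_trans ltr01 r1).
Qed.

Lemma conjugate_ge1 (R : realType) (r : \bar R) : (1 < r)%E ->
  1 <= fine (hoelder_conjugate r).
Proof.
case: r => [r| |//]; last by rewrite hoelder_conjugatey.
rewrite lte_fin => r1; rewrite conjugate_real// ler_pdivlMr ?subr_gt0// mul1r.
by rewrite gerBl.
Qed.

Lemma mean_norm_gt0 (R : realType) (phi : R -> R) : torus_continuous phi ->
  (exists x, phi x != 0) -> 0 < mean (fun x => `|phi x|).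
Proof.
move=> tc [x0 fx0]; have bphi := bmeas_torus _ _ tc; case: tc => cphi pphi.
have [y [/andP[y0 y1] fy]] := periodic_fracE _ _ x0 pphi.
have f0 : 0 < `|phi y| by rewrite -fy normr_gt0.
pose c := `|phi y| / 2; have c0 : 0 < c by rewrite divr_gt0.
have cn : (fun x => `|phi x|) x @[x --> y] --> `|phi y|.
  by apply: cvg_norm; exact: cphi.
have /nbhs_ballP[d /= d0 hd] : nbhs y [set x : R | c < `|phi x|].
  apply: (@cvgr_gt _ _ _ _ _ _ cn c).
  by rewrite /c ltr_pdivrMr// mulr_natr mulr2n ltrDl.
pose z := Num.min (y + d) 1.
have yz : y < z by rewrite /z lt_min y1 ltrDl d0.
have z1 : z <= 1 by rewrite /z ge_min lexx orbT.
have zd : z <= y + d by rewrite /z ge_min lexx.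
have bi := bmeas_indic_itv R `[y, z[.
apply: (@lt_le_trans _ _ (mean (fun x => c * \1_(`[y, z[%classic) x))).
  by rewrite meanZ// (mean_itv _ _ _ _ _ y0 (ltW yz) z1) mulr_gt0// subr_gt0.
apply: le_mean => [||x]; [exact: bmeasZ|exact: bmeas_norm|].
rewrite indicE mem_setE in_itv/=; case: (boolP (_ && _)) => [/andP[yx xz]|_].
  rewrite mulr1 ltW//; apply: hd; rewrite /ball/= distrC ger0_norm ?subr_ge0//.
  by rewrite ltrBlDl (lt_le_trans xz zd).
by rewrite mulr0.
Qed.

Lemma ae_ge_negpart (R : realType) (phi : R -> R) (M : R) : bmeas phi ->
  Lp_norm +oo%E (phi^\-) <= M -> {ae torus_measure R, forall y, - M <= phi y}.
Proof.
move=> [mphi [B phiB]] hM.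
have bneg : bmeas (phi^\-).
  split; first exact: measurable_funrneg.
  exists B => x; rewrite /funrneg; have := phiB x; have := normr_ge0 (phi x).
  rewrite !ler_norml => B0 /andP[h1 h2].
  rewrite le_max ge_max; apply/andP; split; apply/orP || apply/andP; [right|split]; lra.
apply: (@filterS _ _ (ae_filter_ringOfSetsType _) _ _ _ (ae_le_Linfty _ _ bneg)) => x /= h.
have := le_trans (ler_norm _) (le_trans h hM).
by rewrite /funrneg ge_max lerNl => /andP[].
Qed.

(** |phi| <= |phi + M| + M, and phi + M is nonnegative with mean M. *)
Lemma mean_norm_le_negpart (R : realType) (phi : R -> R) (M : R) : bmeas phi ->
  mean phi = 0 -> {ae torus_measure R, forall y, - M <= phi y} -> 0 <= M ->
  mean (fun x => `|phi x|) <= 2 * M.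
Proof.
move=> bphi phi0 aeM M0.
have bpM := bmeasD _ _ _ bphi (bmeas_cst R M).
have e : mean (fun x => `|phi x + M|) = M.
  transitivity (mean (fun x => phi x + M)).
    congr fine; apply: ae_eq_integral => //.
    - by apply/measurable_EFinP; have [] := bmeas_norm _ _ bpM.
    - by apply/measurable_EFinP; have [] := bpM.
    - apply: (@filterS _ _ (ae_filter_ringOfSetsType _) _ _ _ aeM) => y My _ /=.
      by rewrite ger0_norm// -lerBlDr sub0r.
  by rewrite meanD ?phi0 ?mean_cst ?add0r//; exact: bmeas_cst.
have -> : 2 * M = mean (fun x => `|phi x + M| + M).
  rewrite meanD ?e ?mean_cst; [ring|exact: bmeas_norm|exact: bmeas_cst].
apply: le_mean => [||x].
- exact: bmeas_norm.
- by apply: bmeasD; [exact: bmeas_norm|exact: bmeas_cst].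
- rewrite -{1}(addrK M (phi x)) (le_trans (ler_normB _ _))// lerD2l ger0_norm//.
Qed.

(** * The inequality *)

Lemma normc_fourier_coef (R : realType) (phi : R -> R) (k : nat) :
  ComplexField.Normc.normc (fourier_coef phi k%:Z) = coef_norm phi k.
Proof. by rewrite /fourier_coef /= sqrrN. Qed.

Lemma L1_le_Lp (R : realType) (f : R -> R) (r : \bar R) : (1 < r)%E -> bmeas f ->
  mean (fun x => `|f x|) <= Lp_norm r f.
Proof.
move=> r1 bf; have := mass_on_set_le _ _ _ _ r1 bf measurableT.
rewrite indicT; under eq_fun do rewrite mul1r.
by rewrite mean_cst powR1 mulr1.
Qed.

Lemma powR_div_mul (R : realType) (m N t : R) : 0 < m -> 0 < N ->
  N * (m / N) `^ (1 + t) = m `^ (1 + t) / N `^ t.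
Proof.
move=> m0 N0; rewrite powRM ?(ltW m0) ?invr_ge0 ?(ltW N0)//.
rewrite -(powR_inv1 (ltW N0)) -powRrM mulN1r powRN.
rewrite (@powRD _ N); last by rewrite (gt_eqF N0) implybT.
rewrite (powRr1 (ltW N0)) invfM mulrCA; congr (_ * _).
by rewrite mulrA divff ?mul1r// gt_eqF.
Qed.

(** The set A, on which |prim phi| >= m / (8 N), has measure at least (t / 2) ^ r' with
    t = m / |phi|_r, because it carries half of the mass, and at most
    2 (c X / lam) ^ s by the level set bound. Comparing s-th roots gives the result. *)
Lemma sign_change_bound (R : realType) (s : R) (r : \bar R) : 2 <= s -> (1 < r)%E ->
  let s' := fine (hoelder_conjugate s%:E) in
  let r' := fine (hoelder_conjugate r) in
  exists2 C : R, 0 < C &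
    forall phi : R -> R, torus_continuous phi -> (exists x, phi x != 0) ->
    mean phi = 0 -> (sign_changes phi < +oo)%E ->
    forall M : R, Lp_norm +oo%E (phi^\-) <= M -> forall n : nat, (1 <= n)%N ->
    C * (Lp_norm r phi * (mean (fun x => `|phi x|) / Lp_norm r phi) `^ (1 + r' / s)) <=
    fine (sign_changes phi) *
      (M / n%:R + (\sum_(1 <= k < n) (coef_norm phi k / k%:R) `^ s') `^ s'^-1).
Proof.
move=> s2 r1 s' r'.
have s1 : 1 < s by lra.
have s0 : 0 < s by lra.
have s'E : s' = s / (s - 1) by rewrite /s' conjugate_real.
have s'1 : 1 <= s' by rewrite /s'; apply: conjugate_ge1; rewrite lte_fin.
have s'0 : 0 < s' by rewrite (lt_le_trans ltr01).
have ss' : (s - 1) * (s' - 1) = 1.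
  by rewrite s'E; field; rewrite subr_eq0 gt_eqF.
have r'1 : 1 <= r' by exact: conjugate_ge1.
have r'0 : 0 < r' by rewrite (lt_le_trans ltr01).
have [c c0 level] : exists2 c : R, 0 < c & forall (n : nat) (phi : R -> R)
    (M X lam : R) (A : set R), (0 < n)%N -> bmeas phi -> mean phi = 0 ->
    {ae torus_measure R, forall y, - M <= phi y} -> 0 < X -> M / n%:R <= X ->
    \sum_(1 <= k < n) (coef_norm phi k / k%:R) `^ s' <= X `^ s' ->
    0 < lam -> measurable A -> (forall x, A x -> 0 <= x <= 1 /\ lam <= `|prim phi x|) ->
    mean (\1_A : R -> R) <= 2 * (c * X / lam) `^ s.
  exists 512; first by rewrite ltr0n.
  by move=> *; apply: (prim_level_set_le R s s'); eassumption.
pose D := 2 `^ s^-1 * 2 `^ (r' / s) * (c * 8).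
have D0 : 0 < D by rewrite !mulr_gt0 ?powR_gt0.
exists D^-1; first by rewrite invr_gt0.
move=> phi tc nz phi0 fin M hM n n1.
have bphi := bmeas_torus _ _ tc.
have m0 := mean_norm_gt0 _ _ tc nz.
have aeM := ae_ge_negpart _ _ _ bphi hM.
have M0 : 0 <= M by rewrite (le_trans _ hM)// Lp_norm_ge0.
have mM := mean_norm_le_negpart _ _ _ bphi phi0 aeM M0.
set m := mean (fun x => `|phi x|) in m0 mM *.
have Mp : 0 < M by move: (lt_le_trans m0 mM); rewrite pmulr_rgt0.
have Rm : m <= Lp_norm r phi by exact: L1_le_Lp.
have R0 : 0 < Lp_norm r phi by exact: lt_le_trans Rm.
set N := fine (sign_changes phi).
have N2 : 2 <= N by exact: sign_changes_ge2.
have N0 : 0 < N by rewrite (lt_le_trans _ N2).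
set S := \sum_(_ <= _ < _) _.
have S0 : 0 <= S by apply: sumr_ge0 => k _; exact: powR_ge0.
set X := M / n%:R + S `^ s'^-1.
have nn : 0 < (n%:R : R) by rewrite ltr0n.
have Mn : 0 < M / n%:R by rewrite divr_gt0.
have X0 : 0 < X by rewrite ltr_wpDr ?powR_ge0.
have MX : M / n%:R <= X by rewrite lerDl powR_ge0.
have SX : S <= X `^ s'.
  have -> : S = (S `^ s'^-1) `^ s' by rewrite -powRrM mulVf ?gt_eqF// powRr1.
  apply: ge0_ler_powR; rewrite ?nnegrE ?powR_ge0 ?(ltW s'0) ?(ltW X0)//.
  by rewrite lerDr ltW.
have [A [mA hA mass]] := large_prim_mass _ _ m N tc phi0 erefl m0 fin erefl.
pose lam := m / (8 * N).
have l0 : 0 < lam by rewrite divr_gt0// mulr_gt0.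
have lev := level n phi M X lam A n1 bphi phi0 aeM X0 MX SX l0 mA hA.
have hol := le_trans mass (mass_on_set_le _ _ _ _ r1 bphi mA).
rewrite -/r' in hol.
set mu := mean (\1_A : R -> R) in lev hol.
have mu0 : 0 <= mu by apply: mean_ge0 => x; rewrite indicE.
set t := m / Lp_norm r phi.
have t0 : 0 < t by rewrite divr_gt0.
have t2 : 0 <= t / 2 by rewrite divr_ge0// ltW.
have h1 : (t / 2) `^ r' <= mu.
  have -> : mu = (mu `^ r'^-1) `^ r' by rewrite -powRrM mulVf ?gt_eqF// powRr1.
  apply: ge0_ler_powR; rewrite ?nnegrE ?powR_ge0 ?(ltW r'0)//.
  by rewrite /t mulrAC ler_pdivrMr// [leRHS]mulrC.
have cX : 0 <= c * X / lam by apply: divr_ge0; [exact: mulr_ge0 (ltW c0) (ltW X0) | exact: ltW].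
have h2 : (t / 2) `^ (r' / s) <= 2 `^ s^-1 * (c * X / lam).
  have -> : 2 `^ s^-1 * (c * X / lam) = (2 * (c * X / lam) `^ s) `^ s^-1.
    rewrite powRM ?powR_ge0//; congr (_ * _).
    by rewrite -powRrM mulfV ?gt_eqF// powRr1.
  rewrite powRrM; apply: ge0_ler_powR; rewrite ?nnegrE ?powR_ge0 ?invr_ge0 ?(ltW s0)//.
    by rewrite mulr_ge0// powR_ge0.
  exact: le_trans h1 lev.
have tE : t `^ (r' / s) = 2 `^ (r' / s) * (t / 2) `^ (r' / s).
  by rewrite -powRM//; congr (_ `^ _); rewrite mulrCA divff ?mulr1.
have -> : Lp_norm r phi * t `^ (1 + r' / s) = m * t `^ (r' / s).
  rewrite powRD; last by rewrite (gt_eqF t0) implybT.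
  by rewrite (powRr1 (ltW t0)) mulrA; congr (_ * _); rewrite /t mulrCA divff ?mulr1// gt_eqF.
rewrite mulrC ler_pdivrMr// tE.
have -> : N * X * D = m * (2 `^ (r' / s) * (2 `^ s^-1 * (c * X / lam))).
  rewrite /D /lam; move: (2 `^ _) (2 `^ _) => u v.
  by field; rewrite (gt_eqF m0) (gt_eqF N0).
by rewrite ler_pM2l// ler_pM2l ?powR_gt0.
Qed.

Lemma inve_fin (R : realType) (p : \bar R) : (1 <= p)%E ->
  exists a : R, [/\ (p^-1)%E = a%:E, 0 <= a & a <= 1].
Proof.
case: p => [p| |//]; last by exists 0; rewrite invey ler01 lexx.
rewrite lee_fin => p1; exists p^-1.
have p0 : 0 < p by rewrite (lt_le_trans ltr01).
by rewrite inver gt_eqF// invr_ge0 ltW// invf_le1.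
Qed.

(** With t = |phi|_1 / |phi|_r <= 1, interpolation bounds each of the two norms by
    |phi|_r times a power of t. Because r' (1 - 1 / r) = 1, the hypothesis on p, q, r
    says that the two exponents add up to at least 1 + r' / s. *)
Lemma norm_product_ratio_le (R : realType) (s : R) (p q r : \bar R) (phi : R -> R) :
  0 < s -> (1 <= p)%E -> (1 <= q)%E -> (1 <= r)%E ->
  (1 + s%:E^-1 <= p^-1 + q^-1 - r^-1)%E ->
  (1 < r)%E /\
  (bmeas phi -> 0 < mean (fun x => `|phi x|) ->
   Lp_norm p phi * Lp_norm q phi / Lp_norm r phi <=
   Lp_norm r phi * (mean (fun x => `|phi x|) / Lp_norm r phi) `^
     (1 + fine (hoelder_conjugate r) / s)).
Proof.
move=> s0 p1 q1 r1.
have [a [pa a0 a1]] := inve_fin _ _ p1.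
have [b [qb b0 b1]] := inve_fin _ _ q1.
have [c [rc c0 c1]] := inve_fin _ _ r1.
rewrite pa qb rc inver (gt_eqF s0) -!EFinD lee_fin => h.
have sV : 0 < s^-1 by rewrite invr_gt0.
have r1' : (1 < r)%E.
  rewrite lt_neqAle r1 andbT; apply/eqP => rE.
  by move: rc; rewrite -rE inve1 => -[ce]; lra.
split=> // bphi m0.
set m := mean _ in m0 *; set Rn := Lp_norm r phi.
have mR : m <= Rn by exact: L1_le_Lp.
have R0 : 0 < Rn by exact: lt_le_trans mR.
have t0 : 0 < m / Rn by rewrite divr_gt0.
have t1 : m / Rn <= 1 by rewrite ler_pdivrMr// mul1r.
have interp (p' : \bar R) (a' : R) : (1 <= p')%E -> (p'^-1)%E = a'%:E -> c < a' ->
    Lp_norm p' phi <= Rn * (m / Rn) `^ ((a' - c) * fine (hoelder_conjugate r)).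
  case: p' => [p'| |//]; last first.
    by rewrite invey => _ [<-]; lra.
  rewrite lee_fin => p'1; have p'0 : 0 < p' by rewrite (lt_le_trans ltr01).
  rewrite inver (gt_eqF p'0) => -[<-] cp.
  have -> : c = fine (r^-1)%E by rewrite rc.
  apply: Lp_interpolation => //.
  case: (r) r1' rc => [r0| |//]; last by move=> *; rewrite ltry.
  rewrite !lte_fin => r01; have r00 : 0 < r0 by rewrite (lt_trans ltr01).
  by rewrite inver (gt_eqF r00) => -[rc]; rewrite -rc ltf_pV2// in cp.
have hp := interp p a p1 pa _; have hq := interp q b q1 qb _.
have {}hp := hp ltac:(lra); have {}hq := hq ltac:(lra).
have cc := conjugateM _ _ r1'; rewrite rc/= in cc.
have r'1 := conjugate_ge1 _ _ r1'.
move: cc r'1 hp hq; set r' := fine (hoelder_conjugate r) => cc r'1 hp hq.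
rewrite ler_pdivrMr//.
apply: le_trans (ler_pM (Lp_norm_ge0 _ _ _) (Lp_norm_ge0 _ _ _) hp hq) _.
rewrite mulrACA -powRD; last by rewrite (gt_eqF t0) implybT.
rewrite [leRHS]mulrAC ler_pM2l ?mulr_gt0//.
apply: ger_powR; first by rewrite t0 t1.
rewrite -mulrDl.
have -> : 1 + r' / s = r' * (1 - c + s^-1) by rewrite mulrDr cc.
rewrite [leRHS]mulrC ler_pM2l; last by rewrite (lt_le_trans ltr01).
by lra.
Qed.

Theorem theorem3p2 (R : realType) (s : R) (hs : 2 <= s) (Rphi : (R -> R) -> R)
  (hR :
    (* case (i) *)
    (exists p q r : \bar R,
       [/\ (1 <= p)%E, (1 <= q)%E, (1 <= r)%E,
           (1 + s%:E^-1 <= p^-1 + q^-1 - r^-1)%E &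
           Rphi = fun phi => Lp_norm p phi * Lp_norm q phi / Lp_norm r phi])
    \/
    (* case (ii) *)
    (exists r : \bar R,
       (1 < r)%E /\
       let r' := fine (hoelder_conjugate r) in
       Rphi = fun phi => Lp_norm 1%E phi `^ (1 + r' / s)
                         / Lp_norm r phi `^ (r' / s))) :
  let s' := fine (hoelder_conjugate s%:E) in
  exists C : R, 0 < C /\
    forall phi : R -> R,
      torus_continuous phi -> (exists x, phi x != 0) -> zero_mean phi ->
      (sign_changes phi < +oo)%E ->
      forall M : R, Lp_norm +oo%E (phi^\-) <= M ->
      forall n : nat, (1 <= n)%N ->
        C * Rphi phi <=
        fine (sign_changes phi) *
        (M / n%:R +
         (\sum_(1 <= k < n)
            ComplexField.Normc.normc (fourier_coef phi k%:Z) `^ s' / k%:R `^ s')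
           `^ s'^-1).
Proof.
move=> s'.
have s0 : 0 < s by lra.
have sumE (phi : R -> R) (n : nat) : \sum_(1 <= k < n)
    ComplexField.Normc.normc (fourier_coef phi k%:Z) `^ s' / k%:R `^ s' =
    \sum_(1 <= k < n) (coef_norm phi k / k%:R) `^ s'.
  apply: eq_bigr => k _; rewrite normc_fourier_coef powRM ?sqrtr_ge0 ?invr_ge0//.
  by rewrite -[in RHS]powR_inv1// -powRrM mulN1r powRN.
have [r [r1 hred]] : exists r : \bar R, (1 < r)%E /\ forall phi : R -> R,
    torus_continuous phi -> (exists x, phi x != 0) ->
    Rphi phi <= Lp_norm r phi * (mean (fun x => `|phi x|) / Lp_norm r phi) `^
      (1 + fine (hoelder_conjugate r) / s).
  case: hR => [[p [q [r [p1 q1 r1 hpqr ->]]]]|[r [r1 ->]]]; exists r.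
    split; first by have [] := norm_product_ratio_le _ _ _ _ _ (fun=> 0) s0 p1 q1 r1 hpqr.
    move=> phi tc nz; have [_] := norm_product_ratio_le _ _ _ _ _ phi s0 p1 q1 r1 hpqr.
    by apply; [exact: bmeas_torus | exact: mean_norm_gt0].
  split=> // phi tc nz; have bphi := bmeas_torus _ _ tc.
  have m0 := mean_norm_gt0 _ _ tc nz.
  have R0 := lt_le_trans m0 (L1_le_Lp _ _ _ r1 bphi).
  by rewrite powR_div_mul// L1_normE.
have [C C0 hC] := sign_change_bound _ _ _ hs r1.
exists C; split=> // phi tc nz zm fin M hM n n1.
rewrite sumE; apply: le_trans (hC phi tc nz zm fin M hM n n1).
by rewrite ler_pM2l// hred.
Qed.
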